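(* Let $M$ be a $3$-connected matroid, let $N$ be a minor of $M$ without loops or coloops, let $\mathcal{T}$ be a tangle of $M$ of order at least $3$, let $X$ be a long line of the tangle matroid $M(\mathcal{T})$, and let $f\in X$. If $(X\setminus f)\cap E(N)=\emptyset$, then there exists $e\in X\setminus f$ such that either $M\setminus e$ or $M/ e$ is $3$-connected with $N$ as a minor.
   Context: $\lambda_M(X) = \rank_M(X) + \rank_M(E(M)\setminus X) - \rank(M)$. A tangle of order $\theta$ of $M$ is a collection $\mathcal{T}$ of subsets of $E(M)$ such that: (i) $\lambda_M(X)<\theta$ for all $X\in\mathcal{T}$; (ii) for every $X\subseteq E(M)$ with $\lambda_M(X)<\theta$, either $X\in\mathcal{T}$ or $E(M)\setminus X\in\mathcal{T}$; (iii) if $X,Y,Z\in\mathcal{T}$ then $X\cup Y\cup Z\neq E(M)$; (iv) $E(M)\setminus\{e\}\notin\mathcal{T}$ for every $e\in E(M)$. The tangle matroid $M(\mathcal{T})$ is the matroid on $E(M)$ with rank function $\rank_{\mathcal{T}}(X) = \min\{\lambda_M(Y): X\subseteq Y\in\mathcal{T}\}$ if some member of $\mathcal{T}$ contains $X$, and $\rank_{\mathcal{T}}(X)=\theta$ otherwise. A line of a matroid is a closed set of rank $2$; it is long if it has at least $3$ elements. ''$M'$ has $N$ as a minor'' means $N$ itself (with labelled ground set) equals $M'/C\setminus D$ for some disjoint $C,D\subseteq E(M')$. *)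

(* Defs.v *)
From mathcomp Require Import all_boot.
Set Warnings "-notation-overridden".
Set Implicit Arguments. Unset Strict Implicit. Unset Printing Implicit Defensive.

Section Matroids.
Variable T : finType.

(* Raw matroid data: a ground set E(M) (a subset of the label universe T)
   and a rank function (only meaningful on subsets of the ground set). *)
Record mdata := MData { ground : {set T}; rk : {set T} -> nat }.

Definition is_matroid (M : mdata) : Prop :=
  [/\ (forall X : {set T}, X \subset ground M -> rk M X <= #|X|),
      (forall X Y : {set T}, X \subset Y -> Y \subset ground M -> rk M X <= rk M Y) &
      (forall X Y : {set T}, X \subset ground M -> Y \subset ground M ->
         rk M (X :|: Y) + rk M (X :&: Y) <= rk M X + rk M Y)].

Definition lambda (M : mdata) (X : {set T}) : nat :=
  rk M X + rk M (ground M :\: X) - rk M (ground M).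

Definition three_connected (M : mdata) : Prop :=
  forall k (X : {set T}), k < 3 -> X \subset ground M -> k <= #|X| ->
    k <= #|ground M :\: X| -> k <= lambda M X.

Definition is_loop (M : mdata) (e : T) : Prop :=
  e \in ground M /\ rk M [set e] = 0.
Definition is_coloop (M : mdata) (e : T) : Prop :=
  e \in ground M /\ rk M (ground M :\ e) < rk M (ground M).

Definition minor_of (M : mdata) (C D : {set T}) : mdata :=
  MData (ground M :\: (C :|: D)) (fun X => rk M (X :|: C) - rk M C).
Definition mdelete (M : mdata) (e : T) : mdata := minor_of M set0 [set e].
Definition mcontract (M : mdata) (e : T) : mdata := minor_of M [set e] set0.

Definition meq (N M : mdata) : Prop :=
  ground N = ground M /\ forall X : {set T}, X \subset ground N -> rk N X = rk M X.

Definition has_minor (M N : mdata) : Prop :=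
  exists C D : {set T}, [/\ C \subset ground M, D \subset ground M,
    [disjoint C & D] & meq N (minor_of M C D)].

Definition is_tangle (M : mdata) (Tg : {set {set T}}) (theta : nat) : Prop :=
  [/\ (forall X : {set T}, X \in Tg -> X \subset ground M),
      (forall X : {set T}, X \in Tg -> lambda M X < theta),
      (forall X : {set T}, X \subset ground M -> lambda M X < theta ->
          X \in Tg \/ (ground M :\: X) \in Tg),
      (forall X Y Z : {set T}, X \in Tg -> Y \in Tg -> Z \in Tg ->
          X :|: Y :|: Z != ground M) &
      (forall e, e \in ground M -> (ground M :\ e) \notin Tg)].

(* Tangle matroid rank: min of lambda(Y) over members Y of Tg containing X,
   and theta if there is none (every such lambda(Y) is < theta, so the
   default theta of the min is exactly the paper's convention). *)
Definition tangle_rk (M : mdata) (Tg : {set {set T}}) (theta : nat)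
    (X : {set T}) : nat :=
  \big[minn/theta]_(Y in Tg | X \subset Y) lambda M Y.

Definition tangle_matroid (M : mdata) (Tg : {set {set T}}) (theta : nat) : mdata :=
  MData (ground M) (tangle_rk M Tg theta).

Definition is_closed (M : mdata) (X : {set T}) : Prop :=
  X \subset ground M /\
  forall e, e \in ground M :\: X -> rk M X < rk M (e |: X).

Definition is_line (M : mdata) (X : {set T}) : Prop :=
  is_closed M X /\ rk M X = 2.

Definition is_long_line (M : mdata) (X : {set T}) : Prop :=
  is_line M X /\ 3 <= #|X|.

End Matroids.

(* Main.v *)
(* Write r for the rank of M and r' for the rank of its dual.  A long line X of
   the tangle matroid is a maximal 3-separating member of the tangle, so when M/e
   is not 3-connected for some e in X, uncrossing in the tangle gives a guts pair
   (e, P): a 3-separating set P of X - e with e in the closures of both P and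
   E - P - e.  Dually for M\e.

   Suppose that no e in X - f works.  Then every e that may be contracted while
   keeping N lies in a guts pair, and dually for deletion.  If (e, P) is a guts
   pair with |P| > 2, then every p <> f in P may also be contracted, unless P
   contains a smaller guts pair for e (when f is in N this is Tutte's linking
   theorem applied to f).  Uncrossing the guts pairs of p and e therefore descends
   to |P| = 2, that is, to triangles and triads in X carrying an element that may
   be contracted, resp. deleted.  If such a triangle meets a triad, they form a
   fan of length four whose end elements may be removed; a fan is then extended
   forever inside X, starting at an end from which f is not reached, which is
   absurd.  Otherwise a second descent, alternating between M and its dual,
   again produces ever smaller guts pairs. *)
Require Import Defs.
From mathcomp Require Import all_boot.
From mathcomp Require Import zify.
From Stdlib Require Import Classical.
Set Implicit Arguments. Unset Strict Implicit. Unset Printing Implicit Defensive.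

(** * Deciding set identities by computation *)

Definition allb (P : bool -> bool) := P true && P false.

(** Lets [bool_dec] turn a goal quantified over booleans into a closed boolean that [vm_compute]
    evaluates. *)
Lemma allbP P : allb P -> forall b, P b.
Proof. by case/andP=> h1 h2 []. Qed.

Lemma imply_elim (a b : bool) : a -> a ==> b -> b.
Proof. by move=> ->. Qed.

Lemma subset_elim (T : finType) (A B : {set T}) z (b : bool) :
  A \subset B -> ((z \in A) ==> (z \in B)) ==> b -> b.
Proof. by move/subsetP/(_ z)/implyP => ->. Qed.

Ltac push_mem z :=
  repeat match goal with
  | H : is_true (_ \subset _) |- _ => apply: (subset_elim (z := z) H); clear H
  end.
Ltac push_facts :=
  repeat match goal with
  | H : is_true (in_mem _ (mem ?A)) |- _ =>
    tryif is_var A then fail else (apply: (imply_elim H); clear H)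
  | H : is_true (~~ in_mem _ (mem ?A)) |- _ =>
    tryif is_var A then fail else (apply: (imply_elim H); clear H)
  end.
Ltac use_facts :=
  repeat match goal with
  | H : is_true (in_mem ?x ?A) |- context [in_mem ?x ?A] => rewrite H
  | H : is_true (~~ in_mem ?x ?A) |- context [in_mem ?x ?A] => rewrite (negPf H)
  | H : is_true (~~ (?x == ?y)) |- context [?x == ?y] => rewrite (negPf H)
  | H : is_true (~~ (?x == ?y)) |- context [?y == ?x] => rewrite (eq_sym y x) (negPf H)
  end.
Ltac absurd_facts :=
  match goal with
  | H : is_true (~~ (?x == ?x)) |- _ => by rewrite eqxx in H
  | H : is_true (in_mem ?x ?A), K : is_true (~~ in_mem ?x ?A) |- _ => by rewrite H in K
  end.
Ltac split_eq :=
  rewrite ?eqxx; use_facts;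
  repeat match goal with
  | |- context [@eq_op _ ?x ?y] =>
      case: (eqVneq x y) => [?|?]; [subst | ]; rewrite ?eqxx;
      try absurd_facts; use_facts
  end.
Ltac bool_dec :=
  try absurd_facts; use_facts;
  repeat match goal with
  | |- context [in_mem ?x ?A] =>
    let b := fresh "b" in generalize (in_mem x A) => b
  end;
  repeat match goal with
  | b : bool |- _ => move: b; refine (allbP _)
  end; vm_compute; reflexivity.
(* Decides equality and inclusion of finite sets by a truth table over the
   membership of a generic element. *)
Ltac setdec_at z := push_mem z; push_facts; rewrite ?inE; split_eq; bool_dec.
Ltac setdec :=
  match goal with
  | |- _ = _ =>
    let z := fresh "z" in apply/setP => z; apply: Bool.eqb_prop; setdec_at z
  | |- is_true (_ \subset _) =>
    let z := fresh "z" in apply/subsetP => z; apply: elimT implyP _; setdec_at z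
  | |- is_true (in_mem ?z _) => setdec_at z
  | |- is_true (~~ in_mem ?z _) => setdec_at z
  end.

(** * Ranks, 3-separations and guts pairs *)

Section Definitions.
Variable T : finType.
Implicit Types (r : {set T} -> nat) (E A B P : {set T}) (e : T).

(** The axioms range over all subsets of the type, so rank lemmas carry no ground-set side
    conditions; a rank meaningful only on [E] is first composed with intersection with [E]. *)
Definition matroid_rank r :=
  [/\ forall A, r A <= #|A|, {homo r : A B / A \subset B >-> A <= B} &
      forall A B, r (A :|: B) + r (A :&: B) <= r A + r B].

Definition in_cl r e A := r (e |: A) <= r A.

(** Connectivity at most 2, written without truncated subtraction; neither side has to be large. *)
Definition sep E r P := r P + r (E :\: P) <= r E + 2.

(** The case [k = 2] of 3-connectivity, again free of subtraction. *)
Definition conn E r := forall P, P \subset E -> 1 < #|P| -> 1 < #|E :\: P| ->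
  r E + 2 <= r P + r (E :\: P).

(* The element e lies in the guts of the 3-separation (P, E - P), that is,
   (P, E - P - e) is a 2-separation of M/e. *)
Definition guts E r e P :=
  [&& e \in E, e \notin P, P \subset E, 1 < #|P|, sep E r P,
      in_cl r e P & in_cl r e (E :\: (e |: P))].

Definition rank_dual E r r' := forall A, A \subset E -> r' A + r E = #|A| + r (E :\: A).

End Definitions.

(* Otherwise lia case-splits on all the membership hypotheses. *)
Ltac nlia :=
  repeat match goal with
  | H : is_true (in_mem _ _) |- _ => clear H
  | H : is_true (_ \subset _) |- _ => clear H
  | H : is_true (~~ _) |- _ => clear H
  | H : is_true (sep _ _ _) |- _ => clear H
  | H : is_true (in_cl _ _ _) |- _ => clear H
  | H : is_true (guts _ _ _ _) |- _ => clear H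
  | H : forall _, _ |- _ => clear H
  end; lia.

(** * Closure, uncrossing and orthogonality *)

Section Rank.
Variable T : finType.
Implicit Types (r : {set T} -> nat) (A B C D E F P R U V W Z : {set T}) (a b c d e p w x y : T).

Lemma rank_mono r A B : matroid_rank r -> A \subset B -> r A <= r B.
Proof. by case=> _ h _; apply: h. Qed.

Lemma submod r A B C D : matroid_rank r ->
  C \subset A :|: B -> D \subset A :&: B -> r C + r D <= r A + r B.
Proof.
case=> _ mono sub hC hD; apply: leq_trans (sub A B).
by apply: leq_add; apply: mono.
Qed.

Lemma rank_le1 r e A : matroid_rank r -> r (e |: A) <= (r A).+1.
Proof.
move=> mr; have := submod (A := [set e]) (B := A) mr (subxx _) (subxx _).
case: mr => /(_ [set e]); rewrite cards1; nlia.
Qed.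

Lemma in_cl_mono r e A B : matroid_rank r -> A \subset B -> in_cl r e A -> in_cl r e B.
Proof.
move=> mr sAB; rewrite /in_cl => h.
have : r (e |: B) + r A <= r (e |: A) + r B.
  by apply: submod => //; setdec.
nlia.
Qed.

Lemma in_cl_rank r e A : matroid_rank r -> in_cl r e A -> r (e |: A) = r A.
Proof.
move=> mr h; apply/eqP; move: h; rewrite /in_cl eqn_leq => -> /=; apply: rank_mono => //; setdec.
Qed.

(** Connectivity is submodular, and [conn] keeps that of the union at least 2, so that of the
    intersection is at most 2. *)
Lemma uncross E r A B : matroid_rank r -> conn E r ->
  A \subset E -> B \subset E -> sep E r A -> sep E r B ->
  1 < #|A :|: B| -> 1 < #|E :\: (A :|: B)| -> sep E r (A :&: B).
Proof.
move=> mr cn sA sB; rewrite /sep => hA hB c1 c2.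
have := cn (A :|: B) _ c1 c2; rewrite subUset sA sB => /(_ isT).
have := submod (A := A) (B := B) mr (subxx _) (subxx _).
have : r (E :\: (A :&: B)) + r (E :\: (A :|: B)) <= r (E :\: A) + r (E :\: B).
  by apply: submod => //; setdec.
nlia.
Qed.


Lemma sep_compl E r P : P \subset E -> sep E r (E :\: P) = sep E r P.
Proof.
move=> sP; rewrite /sep; have -> : E :\: (E :\: P) = P by setdec.
by rewrite addnC.
Qed.

Lemma guts_sep_add E r e P : matroid_rank r -> guts E r e P -> sep E r (e |: P).
Proof.
move=> mr /and5P[eE eP sP cP /and3P[]]; rewrite /sep /in_cl => s i1 i2.
have eq : E :\: P = e |: (E :\: (e |: P)) by setdec.
have : r (E :\: (e |: P)) <= r (E :\: P) by apply: rank_mono => //; setdec.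
nlia.
Qed.

(** Since the far side spans [p], moving [p] there does not raise its rank. If [Z] did not span [p],
    the rank of the near side would drop and the connectivity would fall below 2. *)
Lemma guts_add E r p Z : matroid_rank r -> conn E r ->
  p \in E -> p \notin Z -> Z \subset E -> 1 < #|Z| -> 1 < #|E :\: Z| ->
  sep E r (p |: Z) -> in_cl r p (E :\: (p |: Z)) -> guts E r p Z.
Proof.
move=> mr cn pE pZ sZ c1 c2; rewrite /sep /in_cl => s i.
have := cn Z sZ c1 c2.
have eq : E :\: Z = p |: (E :\: (p |: Z)) by setdec.
have : r (E :\: (p |: Z)) <= r (E :\: Z) by apply: rank_mono => //; setdec.
have : r Z <= r (p |: Z) by apply: rank_mono => //; setdec.
rewrite -eq in i => h1 h2 h3.
rewrite /guts pE pZ sZ c1 /sep /in_cl -eq; apply/and3P; split; nlia.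
Qed.

(** Moving [p] to the side [E :\: P] that spans it keeps that rank; [conn] then forces [p] into the
    closure of [P :\ p], which therefore spans all that [P] spans. *)
Lemma guts_drop E r e P p : matroid_rank r -> conn E r ->
  guts E r e P -> p \in P -> 2 < #|P| -> 1 < #|E :\: P| -> in_cl r p (E :\: P) ->
  guts E r e (P :\ p).
Proof.
move=> mr cn /and5P[eE eP sP cP /and3P[]] s i1 i2 pP c3 c4 i3.
have cPp : 1 < #|P :\ p| by move: (cardsD1 p P); rewrite pP; nlia.
have c5 : 1 < #|E :\: (P :\ p)|.
  by apply: leq_trans c4 _; apply: subset_leq_card; setdec.
have := cn (P :\ p) _ cPp c5.
have -> : P :\ p \subset E by setdec.
move=> /(_ isT).
have eq : E :\: (P :\ p) = p |: (E :\: P) by setdec.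
move: s i3; rewrite /sep /in_cl -eq => s i3 h.
have hp : in_cl r p (P :\ p).
  rewrite /in_cl; have -> : p |: (P :\ p) = P by setdec.
  nlia.
have iP : r (P :\ p) = r P.
  by rewrite -(in_cl_rank mr hp); congr (r _); setdec.
rewrite /guts eE cPp /sep.
have -> /= : e \notin P :\ p by rewrite !inE (negPf eP) andbF.
have -> /= : P :\ p \subset E by setdec.
apply/and3P; split.
- nlia.
- rewrite /in_cl iP; apply: leq_trans i1; apply: rank_mono => //; setdec.
- by apply: in_cl_mono i2 => //; setdec.
Qed.

Section Uncross.
Variables (E X : {set T}) (r : {set T} -> nat).
Hypotheses (mr : matroid_rank r) (cn : conn E r) (sX : X \subset E)
  (cB : 1 < #|E :\: X|).

Lemma card_compl Z : Z \subset X -> 1 < #|E :\: Z|.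
Proof. by move=> sZ; apply: leq_trans cB _; apply: subset_leq_card; setdec. Qed.

(** This drives the descents. Let [S] be the side opposite to [R]. Uncrossing [W] or [x |: W] with
    [p |: R] or [p |: S] gives a 3-separating [p |: Z] with [Z] inside one side, while the other
    side spans [p]. This fails only if [R] is a pair split by [x |: W]. *)
Lemma guts_smaller W x p R : x \notin W -> x |: W \subset X -> 2 < #|W| ->
  sep E r W -> sep E r (x |: W) -> p \in W -> guts E r p R -> R \subset X ->
  (exists Z, [/\ Z \subset (x |: W) :\ p, #|Z| < #|W| & guts E r p Z]) \/
  (#|R| = 2 /\ #|R :&: (x |: W)| = 1).
Proof.
move=> xW sWX cW s1 s2 pW gR sR.
have sW : W \subset X by setdec.
have xX : x \in X by apply: (subsetP sWX); rewrite !inE eqxx.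
have [pE pR sRE cR /and3P[s i1 i2]] := and5P gR.
have sp := guts_sep_add mr gR.
have WE : W \subset E by setdec.
have xWE : x |: W \subset E by setdec.
have pRE : p |: R \subset E by setdec.
set S := E :\: (p |: R).
have mk Z : Z \subset x |: W -> p \notin Z -> 1 < #|Z| -> #|Z| < #|W| ->
    sep E r (p |: Z) -> (Z \subset R) || (Z \subset S) ->
    exists Z, [/\ Z \subset (x |: W) :\ p, #|Z| < #|W| & guts E r p Z].
  move=> sZ pZ c1 c2 sz hz; exists Z; split=> //; first by setdec.
  apply: guts_add => //; [by setdec | by apply: card_compl; setdec | ].
  case/orP: hz => hz.
    by apply: in_cl_mono i2 => //; setdec.
  apply: in_cl_mono i1 => //; apply/subsetP => z zR; rewrite !inE.
  have -> : z \in E by apply: (subsetP sRE).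
  have [zp|_] := eqVneq z p; first by move: pR; rewrite -zp zR.
  rewrite /= andbT; apply/negP => /(subsetP hz); by rewrite !inE zR orbT.
have pS : p |: S = E :\: R by rewrite /S; setdec.
have sS : S \subset E by rewrite /S; setdec.
have cWc A B : A \subset B -> 1 < #|A| -> 1 < #|B|.
  by move=> h1 h2; apply: leq_trans h2 (subset_leq_card h1).
have [c1|c1] := ltnP 1 #|W :&: R|.
  left; apply: (mk (W :&: R)) => //; try setdec; last by rewrite subsetIr.
  - by apply: proper_card; apply/properP; split; [rewrite subsetIl|exists p; rewrite // !inE negb_and pR orbT].
  - have -> : p |: (W :&: R) = W :&: (p |: R) by setdec.
    apply: uncross => //.
    + by apply: cWc cR; setdec.
    + by apply: card_compl; setdec.
have e1 : #|(x |: W) :&: R| <= (#|W :&: R|).+1.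
  have h : (x |: W) :&: R \subset x |: (W :&: R) by setdec.
  by apply: leq_trans (subset_leq_card h) _; rewrite cardsU1; nlia.
have pxW : p |: (x |: W) = x |: W by setdec.
have [c2|c2] := ltnP 1 #|(x |: W) :&: R|.
  left; apply: (mk ((x |: W) :&: R)) => //; last by rewrite subsetIr.
  - by rewrite subsetIl.
  - by rewrite !inE negb_and pR orbT.
  - nlia.
  - have -> : p |: ((x |: W) :&: R) = (x |: W) :&: (p |: R) by setdec.
    apply: uncross => //.
    + by apply: cWc cR; setdec.
    + by apply: card_compl; setdec.
have cDI := cardsID (x |: W) R.
rewrite (setIC R) in cDI *.
have [c3|c3] := ltnP 1 #|R :\: (x |: W)|; last by right; nlia.
left.
(* [R] now has two elements outside [x |: W]; they are the room needed to uncross with [p |: S]. *)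
have uS A : A \subset x |: W -> sep E r A -> sep E r (A :&: (p |: S)).
  move=> sA hA; apply: uncross => //; first by setdec.
  - by rewrite pS; setdec.
  - by rewrite pS sep_compl.
  - by rewrite pS; apply: cWc cB; setdec.
  - by rewrite pS; apply: cWc c3; setdec.
have pRW : p \notin (x |: W) :&: R by rewrite !inE negb_and pR orbT.
have [c4|c4] := posnP #|(x |: W) :&: R|.
  have h4 : (x |: W) :&: R \subset set0 by rewrite subset0 -cards_eq0 c4.
  have cp := cardsD1 p W; rewrite pW in cp.
  apply: (mk (W :\ p)).
  - by setdec.
  - by rewrite !inE eqxx.
  - nlia.
  - nlia.
  - have -> : p |: (W :\ p) = W :&: (p |: S) by rewrite pS; setdec.
    by apply: uS => //; setdec.
  - by apply/orP; right; rewrite /S; setdec.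
(* One element of [x |: W] lies in [R]; removing it along with [p] leaves [#|W| - 1] elements. *)
have h5 : #|(x |: W) :\: R| = #|W|.
  have := cardsID R (x |: W); rewrite cardsU1 xW; nlia.
have cp := cardsD1 p ((x |: W) :\: R).
have pin : p \in (x |: W) :\: R by rewrite !inE pR pW orbT.
rewrite pin h5 in cp.
apply: (mk (((x |: W) :\: R) :\ p)).
- by setdec.
- by rewrite !inE eqxx.
- nlia.
- nlia.
- have -> : p |: (((x |: W) :\: R) :\ p) = (x |: W) :&: (p |: S).
    by rewrite pS; setdec.
  by apply: uS.
- by apply/orP; right; rewrite /S; setdec.
Qed.
End Uncross.

Lemma rank0 r : matroid_rank r -> r set0 = 0.
Proof. by case=> /(_ set0); rewrite cards0; case: (r set0). Qed.

Lemma sep_dual E r r' P : matroid_rank r -> rank_dual E r r' -> P \subset E ->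
  sep E r' P = sep E r P.
Proof.
move=> mr d sP; rewrite /sep.
have := d _ sP; have := d (E :\: P) (subsetDl _ _); have := d E (subxx _).
have -> : E :\: (E :\: P) = P by setdec.
rewrite setDv (rank0 mr); have := cardsID P E; have -> : E :&: P = P by setdec.
nlia.
Qed.

(** Orthogonality: [e] is in the coclosure of [P] exactly when the complementary set does not span
    it. *)
Lemma in_cl_dual E r r' e P : rank_dual E r r' -> P \subset E -> e \in E ->
  e \notin P -> in_cl r' e P -> in_cl r e (E :\: (e |: P)) -> False.
Proof.
move=> d sP eE eP; rewrite /in_cl.
have := d _ sP; have := d (e |: P); have -> : e |: P \subset E by setdec.
rewrite cardsU1 eP; have -> : e |: (E :\: (e |: P)) = E :\: P by setdec.
by move=> /(_ isT); nlia.
Qed.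

(** * The abstract situation inside [X] *)

Section Context.
Variables (E X : {set T}) (f : T).

(* Ct x and Dl x stand for: contracting, resp. deleting, x keeps N as a minor.
   The fields record all that is used of N and of the tangle when no element of
   X - f can be contracted as desired. *)
Record half_ctx r r' (Ct Dl : T -> Prop) : Prop := Half {
  half_rank : matroid_rank r;
  half_conn : conn E r;
  half_dual : rank_dual E r r';
  half_guts : forall e, e \in X -> e != f -> Ct e ->
    exists2 P : {set T}, P \subset X & guts E r e P;
  half_contract : forall e P p, Ct e -> P \subset X -> guts E r e P ->
    2 < #|P| -> p \in P -> p != f ->
    Ct p \/ exists2 P' : {set T}, P' \proper P & guts E r e P';
  half_triangle : forall A a b, A \subset X -> #|A| = 3 -> r A <= 2 ->
    a \in A -> b \in A -> a != b -> b != f -> Ct a -> Dl b }.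

(** Both halves are kept together so that [ctxC] yields the dual of every later lemma. *)
Definition ctx r r' Ct Dl := half_ctx r r' Ct Dl /\ half_ctx r' r Dl Ct.

Lemma ctxC r r' Ct Dl : ctx r r' Ct Dl -> ctx r' r Dl Ct.
Proof. by case. Qed.

Hypotheses (sX : X \subset E) (cB : 1 < #|E :\: X|).

(** Connectivity at least 2 of a pair forces its rank to be 2, as its complement has rank at most
    [r E]. *)
Lemma rank_pair r a b : conn E r -> matroid_rank r -> a \in X -> b \in X -> a != b ->
  2 <= r [set a; b].
Proof.
move=> cn mr aX bX ab; have c2 : #|[set a; b]| = 2 by rewrite cards2 ab.
have := cn [set a; b]; rewrite c2.
have -> : [set a; b] \subset E by setdec.
move=> /(_ isT isT); rewrite (card_compl sX cB); last by setdec.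
have : r (E :\: [set a; b]) <= r E by apply: rank_mono => //; setdec.
by move=> h /(_ isT); nlia.
Qed.

Lemma triangle_in_cl r A x : conn E r -> matroid_rank r -> A \subset X ->
  #|A| = 3 -> r A <= 2 -> x \in A -> in_cl r x (A :\ x).
Proof.
move=> cn mr sA cA rA xA.
have := cardsD1 x A; rewrite cA xA => c2.
have /cards2P[a [b [ab eq]]] : #|A :\ x| == 2 by apply/eqP; nlia.
have aA : a \in A :\ x by rewrite eq !inE eqxx.
have bA : b \in A :\ x by rewrite eq !inE eqxx orbT.
have h : 2 <= r (A :\ x).
  rewrite eq; apply: rank_pair => //; apply: (subsetP sA).
    by move: aA; rewrite inE => /andP[].
  by move: bA; rewrite inE => /andP[].
by rewrite /in_cl setD1K //; nlia.
Qed.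

(** [conn] applied to a set of rank at most 2 forces [E :\: A] to have full rank, so the far side
    spans [x]. *)
Lemma triangle_guts r A x : conn E r -> matroid_rank r -> A \subset X ->
  #|A| = 3 -> r A <= 2 -> x \in A -> guts E r x (A :\ x).
Proof.
move=> cn mr sA cA rA xA.
have := cardsD1 x A; rewrite cA xA => c2.
have xX := subsetP sA _ xA.
have hi := triangle_in_cl cn mr sA cA rA xA.
have hc := cn A _ _ (card_compl sX cB sA); rewrite cA in hc.
have {}hc := hc (subset_trans sA sX) isT.
have rEA : r (E :\: A) <= r E by apply: rank_mono => //; setdec.
have rEx : r (x |: (E :\: A)) <= r E by apply: rank_mono => //; setdec.
have ic : in_cl r x (E :\: (x |: (A :\ x))) by rewrite setD1K // /in_cl; nlia.
apply: guts_add => //.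
- by setdec.
- by rewrite !inE eqxx.
- by setdec.
- nlia.
- by apply: (card_compl sX cB); setdec.
- by rewrite /sep setD1K //; nlia.
Qed.

Lemma triple_in_cl r a b c : conn E r -> matroid_rank r ->
  uniq [:: a; b; c] -> [set a; b; c] \subset X -> r [set a; b; c] <= 2 ->
  in_cl r c [set a; b].
Proof.
move=> cn mr; rewrite /= !inE negb_or andbT => /andP[/andP[ab ac] bc] sA rA.
have aX : a \in X by apply: (subsetP sA); rewrite !inE eqxx.
have bX : b \in X by apply: (subsetP sA); rewrite !inE eqxx orbT.
have := rank_pair cn mr aX bX ab.
rewrite /in_cl; have -> : c |: [set a; b] = [set a; b; c] by rewrite setUC.
nlia.
Qed.

Section Fan.
Variables (r r' : {set T} -> nat).
Hypotheses (mr : matroid_rank r) (mr' : matroid_rank r') (cn : conn E r)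
  (rr' : rank_dual E r r').

(** As [c] is in the coclosure of [U], the set [c |: U] is still 3-separating. It spans [d] in both
    [r] and [r'], so adding [d] lowers the connectivity to at most 1, and [conn] leaves at most one
    further element. *)
Lemma fan_side U a b c d : U \subset E -> d \in E -> d \notin U -> c \in E ->
  c \notin U -> c != d -> a \in U -> b \in U -> a != b -> 1 < #|U| ->
  in_cl r' d U -> sep E r U -> in_cl r' c [set a; b] -> in_cl r d [set b; c] ->
  #|E :\: (d |: U)| <= 2.
Proof.
move=> sU dE dU cE cU cd aU bU ab cdU i1 s i2 i3.
rewrite leqNgt; apply/negP => cV.
have i4 : in_cl r' c U by apply: in_cl_mono i2 => //; setdec.
have i5 : in_cl r d (c |: U) by apply: in_cl_mono i3 => //; setdec.
have i6 : in_cl r' d (c |: U) by apply: in_cl_mono i1 => //; setdec.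
have cUE : c |: U \subset E by setdec.
have dcU : d \notin c |: U by rewrite !inE negb_or dU eq_sym cd.
have i7 := in_cl_dual rr' cUE dE dcU i6.
have s' : sep E r (c |: U).
  rewrite -(sep_dual mr rr') //; rewrite -(sep_dual mr rr') // in s.
  move: s i4; rewrite /sep /in_cl.
  have : r' (E :\: (c |: U)) <= r' (E :\: U) by apply: rank_mono => //; setdec.
  nlia.
have := @cn (d |: (c |: U)); have -> : d |: (c |: U) \subset E by setdec.
move=> /(_ isT).
have -> : 1 < #|d |: (c |: U)| by apply: leq_trans cdU _; apply: subset_leq_card; setdec.
have -> : 1 < #|E :\: (d |: (c |: U))|.
  have -> : E :\: (d |: (c |: U)) = (E :\: (d |: U)) :\ c by setdec.
  have := cardsD1 c (E :\: (d |: U)).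
  have -> : c \in E :\: (d |: U) by rewrite !inE negb_or cd cU.
  nlia.
move=> /(_ isT isT); move: i5 i7 s'; rewrite /in_cl /sep.
have -> : d |: (E :\: (d |: (c |: U))) = E :\: (c |: U) by setdec.
move=> h1 h2 h3 h4.
have [h|h] := leqP (r (E :\: (c |: U))) (r (E :\: (d |: (c |: U)))); last by nlia.
exact: h2 h.
Qed.

End Fan.
End Context.
End Rank.

(** * Extending fans *)

Section Fans.
Variables (T : finType) (E X : {set T}) (f : T).
Implicit Types (r : {set T} -> nat) (A B C D F P R U V W Z : {set T})
  (a b c d e p w x y : T) (Ct Dl : T -> Prop).
Hypotheses (sX : X \subset E) (cB : 1 < #|E :\: X|).

Lemma card3 a b c : uniq [:: a; b; c] -> #|[set a; b; c]| = 3.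
Proof.
rewrite /= !inE negb_or andbT => /andP[/andP[ab ac] bc].
by rewrite setUC cardsU1 cards2 !inE negb_or ab ![c == _]eq_sym ac bc.
Qed.

(** By orthogonality with the triangle [{b, c, d}], the dual guts pair of [d] separates [b] from
    [c]. [fan_side], applied to the side containing [a], makes the other side small. That other side
    must be [R], and [d |: R] is the next triad. *)
Lemma fan_step r r' a b c d F R :
  matroid_rank r -> matroid_rank r' -> conn E r -> conn E r' ->
  rank_dual E r r' -> rank_dual E r' r ->
  uniq [:: a; b; c; d] -> [set a; b; c; d] \subset F ->
  F \subset X -> r' [set a; b; c] <= 2 -> r [set b; c; d] <= 2 ->
  sep E r (F :\ d) -> guts E r' d R -> R \subset X ->
  exists b' c' w, [/\ (b' = b /\ c' = c) \/ (b' = c /\ c' = b),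
    w \notin F, w \in X & r' [set c'; d; w] <= 2].
Proof.
move=> mr mr' cn cn' rr' r'r.
rewrite /= !inE !negb_or !andbT => /and3P[/and3P[ab ac ad] /andP[bc bd] cd].
move=> sF FX t' t sFd gR sR.
have aF : a \in F by apply: (subsetP sF); rewrite !inE eqxx.
have bF : b \in F by apply: (subsetP sF); rewrite !inE eqxx ?orbT.
have cF : c \in F by apply: (subsetP sF); rewrite !inE eqxx ?orbT.
have dF : d \in F by apply: (subsetP sF); rewrite !inE eqxx ?orbT.
have [aX bX cX dX] : [/\ a \in X, b \in X, c \in X & d \in X].
  by split; apply: (subsetP FX).
have [dE dR sRE cR /and3P[s i1 i2]] := and5P gR.
have id : in_cl r d [set b; c].
  by apply: (triple_in_cl sX cB) => //; [rewrite /= !inE negb_or bc bd cd | setdec].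
have ic : in_cl r' c [set a; b].
  by apply: (triple_in_cl sX cB) => //; [rewrite /= !inE negb_or bc ab ac | setdec].
have ib : in_cl r' b [set a; c].
  apply: (triple_in_cl sX cB) => //.
  - by rewrite /= !inE negb_or (eq_sym c) bc ab ac.
  - by setdec.
  - by have -> : [set a; c; b] = [set a; b; c] by setdec.
have notR : ~~ ((b \in R) && (c \in R)).
  apply/negP => /andP[bR cR'].
  apply: (in_cl_dual (P := E :\: (d |: R)) rr' _ dE _ i2).
  - by setdec.
  - by setdec.
  - by apply: in_cl_mono id => //; setdec.
have notS : (b \in R) || (c \in R).
  apply/negPn/negP; rewrite negb_or => /andP[bR cR'].
  apply: (in_cl_dual (P := R) rr' _ dE _ i1) => //.
  by apply: in_cl_mono id => //; setdec.
have sS : sep E r (E :\: (d |: R)).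
  have dRE : d |: R \subset E by setdec.
  rewrite -(sep_dual mr rr'); last by setdec.
  by rewrite sep_compl //; apply: guts_sep_add.
have sRr : sep E r R by rewrite -(sep_dual mr rr').
have ESR : E :\: (d |: (E :\: (d |: R))) = R by setdec.
have idP u v : u \in R -> v \notin R -> ((u = b /\ v = c) \/ (u = c /\ v = b)) ->
    a \notin R /\ #|R| = 2.
  move=> uR vR uv.
  have [uX vX ud vd] : [/\ u \in X, v \in X, u != d & v != d].
    by case: uv => -[-> ->].
  have av : a != v by case: uv => -[_ ->].
  have au : a != u by case: uv => -[-> _].
  have iu : in_cl r' u [set a; v] by case: uv => -[-> ->].
  have iv : in_cl r' v [set a; u] by case: uv => -[-> ->].
  have iduv : in_cl r d [set v; u] by case: uv => -[-> ->] //; rewrite setUC.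
  have iduv' : in_cl r d [set u; v] by rewrite setUC.
  have [aR|aR] := boolP (a \in R); last first.
    split=> //; apply/eqP; rewrite eqn_leq cR andbT -ESR.
    apply: (fan_side (a := a) (b := v) (c := u) sX cB mr mr' cn rr') => //; try setdec.
    by apply: leq_trans cB _; apply: subset_leq_card; setdec.
  (* Impossible: the far side contains [v] and at least two elements outside [X]. *)
  have : #|E :\: (d |: R)| <= 2.
    by apply: (fan_side (a := a) (b := u) (c := v) sX cB mr mr' cn rr') => //; setdec.
  have : #|v |: (E :\: X)| <= #|E :\: (d |: R)| by apply: subset_leq_card; setdec.
  by rewrite cardsU1 !inE vX; nlia.
have [u [v [uR vR uv]]] : exists u v, [/\ u \in R, v \notin R &
    (u = b /\ v = c) \/ (u = c /\ v = b)].
  case: (boolP (b \in R)) notR notS => /= bR cR' cR''.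
    by exists b, c; split=> //; left.
  by exists c, b; split=> //; right.
have [aR c2] := idP u v uR vR uv.
have /cards1P[w eqw] : #|R :\ u| == 1.
  by have := cardsD1 u R; rewrite uR c2; case: #|_| => [|[]].
have wR : w \in R :\ u by rewrite eqw inE.
have eR : R = [set u; w] by rewrite -(setD1K uR) eqw.
have {}wR : w \in R by move: wR; rewrite inE => /andP[].
have uF : u \in F by case: uv => -[-> _].
have ud : u != d by case: uv => -[-> _].
have wd : w != d by apply: contraNneq dR => <-.
exists v, u, w; split.
- by case: uv => -[-> ->]; [right | left].
(* Otherwise [F :\ d] would span [d] in both ranks, and [F] would have connectivity at most 1. *)
- apply/negP => wF.
  have FE : F :\ d \subset E by clear -FX sX; setdec.
  have dnF : d \notin F :\ d by rewrite !inE eqxx.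
  have i3 : in_cl r d (F :\ d) by apply: in_cl_mono id => //; setdec.
  have i4 : in_cl r' d (F :\ d).
    apply: in_cl_mono i1 => //; rewrite eR; clear -uF wF ud wd; setdec.
  have i5 := in_cl_dual rr' FE dE dnF i4.
  have cF2 : 1 < #|F|.
    by rewrite -c2; apply: subset_leq_card; rewrite eR; clear -uF wF; setdec.
  have := cn F (subset_trans FX sX) cF2 (card_compl sX cB FX).
  move: sFd i3 i5; rewrite /sep /in_cl setD1K //.
  have -> : E :\: (F :\ d) = d |: (E :\: F) by clear -dE dF; setdec.
  move=> h1 h2 h3 h4.
  have [h|h] := leqP (r (d |: (E :\: F))) (r (E :\: F)); last by nlia.
  exact: h3 h.
- exact: (subsetP sR).
- have -> : [set u; d; w] = d |: R by rewrite eR; clear; setdec.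
  apply: leq_trans i1 _; rewrite -c2; by case: mr'.
Qed.

(** The longer fan has the roles of rank and corank exchanged, so the step can be iterated through
    [ctxC]; the new triad passes the label from [d] to [w]. *)
Lemma fan_extend r r' Ct Dl a b c d F : ctx E X f r r' Ct Dl ->
  uniq [:: a; b; c; d] -> [set a; b; c; d] \subset F ->
  F \subset X -> r' [set a; b; c] <= 2 -> r [set b; c; d] <= 2 ->
  sep E r (F :\ d) -> d != f -> Dl d ->
  exists b' c' w, [/\ uniq [:: b'; c'; d; w], [set b'; c'; d; w] \subset w |: F,
    w |: F \subset X, w \notin F &
    [/\ r [set b'; c'; d] <= 2, r' [set c'; d; w] <= 2,
       sep E r' ((w |: F) :\ w), [set b'; c'] = [set b; c] & w != f -> Ct w]].
Proof.
move=> [h h'] un sF FX t' t sFd df Dd.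
have mr := half_rank h; have rr' := half_dual h.
have dF : d \in F by apply: (subsetP sF); rewrite !inE eqxx ?orbT.
have dX := subsetP FX _ dF.
have [R sR gR] := half_guts h' dX df Dd.
have := fan_step mr (half_rank h') (half_conn h) (half_conn h')
  rr' (half_dual h') un sF FX t' t sFd gR sR.
case=> b' [c' [w [bc' wF wX tw]]].
have bF : b \in F by apply: (subsetP sF); rewrite !inE eqxx ?orbT.
have cF : c \in F by apply: (subsetP sF); rewrite !inE eqxx ?orbT.
move: un; rewrite /= !inE !negb_or !andbT => /and3P[/and3P[ab ac ad] /andP[bc bd] cd].
have [b'F c'F] : b' \in F /\ c' \in F by case: bc' => -[-> ->].
have [bw cw dw] : [/\ b' != w, c' != w & d != w].
  by split; apply: contraNneq wF => <-.
have [bc'' bd' cd'] : [/\ b' != c', b' != d & c' != d].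
  by case: bc' => -[-> ->]; split=> //; rewrite eq_sym.
have eqs : [set b'; c'] = [set b; c] by case: bc' => -[-> ->] //; rewrite setUC.
exists b', c', w; split=> //.
- by rewrite /= !inE !negb_or bc'' bd' bw cd' cw dw.
- by setdec.
- by setdec.
split=> //.
- by rewrite eqs.
- rewrite setU1K // (sep_dual mr rr') ?(subset_trans FX sX) //.
  have id : in_cl r d (F :\ d).
    apply: (in_cl_mono _ (A := [set b; c])) => //; first by setdec.
    by apply: (triple_in_cl sX cB (half_conn h)) => //;
      [rewrite /= !inE negb_or bc bd cd | setdec].
  move: sFd id; rewrite /sep /in_cl setD1K //.
  have : r (E :\: F) <= r (E :\: (F :\ d)) by apply: rank_mono => //; setdec.
  nlia.
- move=> wf; apply: (half_triangle h' (A := [set c'; d; w]) (a := d)) => //.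
  + by setdec.
  + by apply: card3; rewrite /= !inE negb_or cd' cw dw.
  + by rewrite !inE eqxx orbT.
  + by rewrite !inE eqxx orbT.
Qed.

(** With [f] already in [F], each new end differs from [f], so the extension never stops and
    exhausts [X]. *)
Lemma fan_f n r r' Ct Dl a b c d F : ctx E X f r r' Ct Dl -> #|X :\: F| < n ->
  uniq [:: a; b; c; d] -> [set a; b; c; d] \subset F ->
  F \subset X -> r' [set a; b; c] <= 2 -> r [set b; c; d] <= 2 ->
  sep E r (F :\ d) -> d != f -> Dl d -> f \in F -> False.
Proof.
elim: n r r' Ct Dl a b c d F => // n IH r r' Ct Dl a b c d F.
move=> h cF un sF FX t' t sFd df Dd fF.
have [b' [c' [w [un' sF' FX' wF [t1 t2 s' _ cw]]]]] :=
  fan_extend h un sF FX t' t sFd df Dd.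
have wf : w != f by apply: contraNneq wF => ->.
apply: (IH _ _ _ _ _ _ _ _ _ (ctxC h) _ un' sF' FX' t1 t2 s' wf (cw wf)).
  have := cardsD1 w (X :\: F).
  have -> : w \in X :\: F by rewrite inE wF (subsetP FX') // !inE eqxx.
  have -> : (X :\: F) :\ w = X :\: (w |: F) by clear; setdec.
  nlia.
by rewrite inE fF orbT.
Qed.

(* The other end y of the fan is remembered: once the extension reaches f, the
   fan contains f and is extended from y instead. *)
Lemma fan_nf n r r' Ct Dl a b c d F y : ctx E X f r r' Ct Dl -> #|X :\: F| < n ->
  uniq [:: a; b; c; d] -> [set a; b; c; d] \subset F ->
  F \subset X -> r' [set a; b; c] <= 2 -> r [set b; c; d] <= 2 ->
  sep E r (F :\ d) -> d != f -> Dl d ->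
  y \in F -> y \notin [set b; c; d] -> sep E r (F :\ y) ->
  (forall F', F \subset F' -> F' \subset X -> f \in F' -> sep E r (F' :\ y) -> False) ->
  False.
Proof.
elim: n r r' Ct Dl a b c d F => // n IH r r' Ct Dl a b c d F.
move=> h cF un sF FX t' t sFd df Dd yF yn sy rev.
have [b' [c' [w [un' sF' FX' wF [t1 t2 s' eqs cw]]]]] :=
  fan_extend h un sF FX t' t sFd df Dd.
have [hr hr'] := h.
have mr := half_rank hr; have rr' := half_dual hr.
have yw : y != w by apply: contraNneq wF => <-.
have yn' : y \notin [set b'; c'; d] by rewrite eqs.
have wyE : (w |: F) :\ y \subset E by clear -FX' sX; setdec.
(* [w] is in the coclosure of [{c', d}], which avoids [y], so adding [w] to [F :\ y] keeps it
   3-separating. *)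
have sy' : sep E r' ((w |: F) :\ y).
  have iw : in_cl r' w (F :\ y).
    apply: (in_cl_mono (half_rank hr') (A := [set c'; d])); last first.
      apply: (triple_in_cl sX cB (half_conn hr') (half_rank hr')) => //.
        by move: un' => /= /andP[_].
      by apply: subset_trans FX'; apply: subset_trans sF'; clear; setdec.
    apply/subsetP => z zcd; rewrite inE.
    have zn : z != w by apply: contraTneq zcd => ->; move: un';
      rewrite /= !inE !negb_or => /and4P[_ /andP[_ c1] c2 _]; rewrite ![w == _]eq_sym c1.
    have : z \in w |: F by apply: (subsetP sF'); move: zcd; rewrite !inE => /orP[] ->; rewrite ?orbT.
    rewrite !inE (negPf zn) /= => ->; rewrite andbT.
    apply: contraTneq zcd => ->; move: yn'; rewrite !inE !negb_or.
    by case/andP=> /andP[_ ->] ->.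
  have FyE : F :\ y \subset E by clear -FX sX; setdec.
  rewrite -(sep_dual mr rr') // in sy.
  move: sy iw; rewrite /sep /in_cl.
  have -> : w |: (F :\ y) = (w |: F) :\ y by clear -yw; setdec.
  have : r' (E :\: ((w |: F) :\ y)) <= r' (E :\: (F :\ y)).
    by apply: rank_mono; [exact: half_rank hr' | clear; setdec].
  nlia.
have [wf|wf] := eqVneq w f.
  apply: (rev (w |: F)) => //; first by rewrite subsetUr.
    by rewrite inE wf !inE eqxx.
  by rewrite -(sep_dual mr rr').
apply: (IH _ _ _ _ _ _ _ _ _ (ctxC h) _ un' sF' FX' t1 t2 s' wf (cw wf)) => //.
- have := cardsD1 w (X :\: F).
  have -> : w \in X :\: F by rewrite inE wF (subsetP FX') // !inE eqxx.
  have -> : (X :\: F) :\ w = X :\: (w |: F) by clear; setdec.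
  nlia.
- by rewrite inE yF orbT.
- move: yn'; rewrite !inE !negb_or => /andP[/andP[_ ->] ->].
  by rewrite yw.
- move=> F' sF'' F'X fF' s''; apply: (rev F') => //.
    by apply: subset_trans sF''; rewrite subsetUr.
  by rewrite -(sep_dual mr rr') //; clear -F'X sX; setdec.
Qed.
End Fans.

(** * Triangles meeting triads *)

Section Descent.
Variables (T : finType) (E X : {set T}) (f : T).
Implicit Types (r : {set T} -> nat) (A B C D F P R U V W Z : {set T})
  (a b c d e p w x y : T) (Ct Dl : T -> Prop).
Hypotheses (sX : X \subset E) (cB : 1 < #|E :\: X|).

Lemma rank_le2_sep r A : matroid_rank r -> r A <= 2 -> sep E r A.
Proof.
move=> mr rA; rewrite /sep; have : r (E :\: A) <= r E.
  by apply: rank_mono => //; clear; setdec.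
by move: rA; clear; lia.
Qed.

(** The fan is read backwards, so that [x1] is the end being extended. *)
Lemma four_fan_end r r' Ct Dl x1 x2 x3 x4 : ctx E X f r r' Ct Dl ->
  uniq [:: x1; x2; x3; x4] -> [set x1; x2; x3; x4] \subset X ->
  r [set x1; x2; x3] <= 2 -> r' [set x2; x3; x4] <= 2 ->
  forall F, [set x1; x2; x3; x4] \subset F -> F \subset X -> f \in F ->
  sep E r (F :\ x1) -> x1 != f -> Dl x1 -> False.
Proof.
move=> h un s4 t t' F sF FX fF s xf D1.
apply: (@fan_f _ E X f sX cB #|X :\: F|.+1 r r' Ct Dl x4 x3 x2 x1 F h) => //.
- by rewrite -[[:: _; _; _; _]]/(rev [:: x1; x2; x3; x4]) rev_uniq.
- by clear -sF; setdec.
- by have -> : [set x4; x3; x2] = [set x2; x3; x4] by clear; setdec.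
- by have -> : [set x3; x2; x1] = [set x1; x2; x3] by clear; setdec.
Qed.

(** Labels pass through the triangle and the triad until [x1] is deletable or [x4] contractible. One
    such end suffices if [f] is in the fan. Otherwise both ends get labels, and the fan is extended
    from [x4] until it meets [f], then from [x1]. *)
Lemma four_fan_lab r r' Ct Dl x1 x2 x3 x4 : ctx E X f r r' Ct Dl ->
  uniq [:: x1; x2; x3; x4] -> [set x1; x2; x3; x4] \subset X ->
  r [set x1; x2; x3] <= 2 -> r' [set x2; x3; x4] <= 2 ->
  (exists2 y, y \in [set x1; x2; x3] & y != f /\ Ct y) -> False.
Proof.
move=> h un s4 t t' [y yA [yf Cy]].
have [hr hr'] := h.
have := un; rewrite /= !inE !negb_or !andbT =>
  /and3P[/and3P[n12 n13 n14] /andP[n23 n24] n34].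
have un' : uniq [:: x4; x3; x2; x1].
  by rewrite -[[:: _; _; _; _]]/(rev [:: x1; x2; x3; x4]) rev_uniq.
have e4 : [set x4; x3; x2; x1] = [set x1; x2; x3; x4] by clear; setdec.
have t2 : r [set x3; x2; x1] <= 2.
  by have -> : [set x3; x2; x1] = [set x1; x2; x3] by clear; setdec.
have t2' : r' [set x4; x3; x2] <= 2.
  by have -> : [set x4; x3; x2] = [set x2; x3; x4] by clear; setdec.
set F := [set x1; x2; x3; x4].
have end1 : x1 != f -> Dl x1 -> forall F', F \subset F' -> F' \subset X ->
    f \in F' -> sep E r (F' :\ x1) -> False.
  by move=> xf D1 F' s1 s2 fF' s; apply: (four_fan_end h un s4 t t' s1 s2 fF' s).
have end4 : x4 != f -> Ct x4 -> forall F', F \subset F' -> F' \subset X ->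
    f \in F' -> sep E r' (F' :\ x4) -> False.
  move=> xf C4 F' s1 s2 fF' s; rewrite -e4 in s4.
  by apply: (four_fan_end (ctxC h) un' s4 t2' t2 _ s2 fF' s) => //; rewrite e4.
have s1 : sep E r (F :\ x1).
  rewrite -(sep_dual (half_rank hr) (half_dual hr)); last by clear -s4 sX; rewrite /F; setdec.
  apply: rank_le2_sep (half_rank hr') _.
  have -> // : F :\ x1 = [set x2; x3; x4] by rewrite /F; clear -n12 n13 n14; setdec.
have s4' : sep E r' (F :\ x4).
  rewrite (sep_dual (half_rank hr) (half_dual hr)); last by clear -s4 sX; rewrite /F; setdec.
  apply: rank_le2_sep (half_rank hr) _.
  have -> // : F :\ x4 = [set x1; x2; x3] by rewrite /F; clear -n14 n24 n34; setdec.
have tri a b : a \in [set x1; x2; x3] -> b \in [set x1; x2; x3] -> a != b ->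
    b != f -> Ct a -> Dl b.
  apply: (half_triangle hr) => //; first by clear -s4; setdec.
  by apply: card3; rewrite /= !inE negb_or n12 n13 n23.
have tri' a b : a \in [set x2; x3; x4] -> b \in [set x2; x3; x4] -> a != b ->
    b != f -> Dl a -> Ct b.
  apply: (half_triangle hr') => //; first by clear -s4; setdec.
  by apply: card3; rewrite /= !inE negb_or n23 n24 n34.
have [m1 m2 m3] : [/\ x1 \in [set x1; x2; x3], x2 \in [set x1; x2; x3] &
    x3 \in [set x1; x2; x3]] by rewrite !inE !eqxx !orbT.
have [m2' m3' m4'] : [/\ x2 \in [set x2; x3; x4], x3 \in [set x2; x3; x4] &
    x4 \in [set x2; x3; x4]] by rewrite !inE !eqxx !orbT.
have both : x1 != f -> x4 != f -> Dl x1 -> Ct x4 -> False.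
  move=> f1 f4 D1 C4.
  have [fF|fF] := boolP (f \in F); first exact: (end1 f1 D1 F).
  apply: (@fan_nf _ E X f sX cB #|X :\: F|.+1 r' r Dl Ct x1 x2 x3 x4 F x1 (ctxC h)) => //.
  - by rewrite !inE eqxx.
  - by rewrite !inE !negb_or n12 n13 n14.
  - by rewrite (sep_dual (half_rank hr) (half_dual hr)) //; clear -s4 sX; rewrite /F; setdec.
  move=> F' sF' F'X fF' s; apply: (end1 f1 D1 F') => //.
  by rewrite -(sep_dual (half_rank hr) (half_dual hr)) //; clear -F'X sX; setdec.
have fin1 : f \in F -> x1 != f -> Dl x1 -> False by move=> fF f1 D1; apply: (end1 f1 D1 F).
have fin4 : f \in F -> x4 != f -> Ct x4 -> False by move=> fF f4 C4; apply: (end4 f4 C4 F).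
have fF1 : x1 = f -> f \in F by move=> <-; rewrite !inE eqxx.
have fF2 : x2 = f -> f \in F by move=> <-; rewrite !inE eqxx ?orbT.
have fF3 : x3 = f -> f \in F by move=> <-; rewrite !inE eqxx ?orbT.
have fF4 : x4 = f -> f \in F by move=> <-; rewrite !inE eqxx ?orbT.
(* once an inner element carries its proper label, so do both ends *)
have inner a b : [\/ a = x2 /\ b = x3 | a = x3 /\ b = x2] -> a != f -> Ct a -> False.
  move=> ab af Ca.
  have [ma mb a1 [nab mb' b4]] : [/\ a \in [set x1; x2; x3], b \in [set x1; x2; x3],
      a != x1 & [/\ a != b, b \in [set x2; x3; x4] & b != x4]].
    by case: ab => -[-> ->]; split=> //; try split=> //; rewrite eq_sym.
  have bF : b = f -> f \in F by case: ab => -[_ ->].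
  have b1 : b != x1 by case: ab => -[_ ->]; rewrite eq_sym.
  have [e1|f1] := eqVneq x1 f.
    have bf : b != f by rewrite -e1.
    have f4 : x4 != f by rewrite -e1 eq_sym.
    apply: (fin4 (fF1 e1) f4); apply: (tri' b) => //.
    exact: tri ma mb nab bf Ca.
  have D1 := tri a x1 ma m1 a1 f1 Ca.
  have [fF|fF] := boolP (f \in F); first exact: fin1.
  have bf : b != f by apply: contraNneq fF.
  have f4 : x4 != f by apply: contraNneq fF.
  apply: both => //; apply: (tri' b) => //.
  exact: tri ma mb nab bf Ca.
move: yA; rewrite !inE -orbA => /or3P[] /eqP ey; last first.
- by rewrite ey in yf Cy; apply: (inner x3 x2) => //; right.
- by rewrite ey in yf Cy; apply: (inner x2 x3) => //; left.
rewrite ey in yf Cy.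
(* Only [x1] is labelled so far: the triangle labels [x2], and the triad turns this into a label on
   [x3], unless [f] interferes. *)
have [e2|f2] := eqVneq x2 f.
  have f3 : x3 != f by rewrite -e2 eq_sym.
  have f4 : x4 != f by rewrite -e2 eq_sym.
  by apply: (fin4 (fF2 e2) f4); apply: (tri' x3) => //; apply: (tri x1).
have D2 : Dl x2 by apply: (tri x1).
have [e3|f3] := eqVneq x3 f.
  have f4 : x4 != f by rewrite -e3 eq_sym.
  by apply: (fin4 (fF3 e3) f4); apply: (tri' x2).
by apply: (inner x3 x2) => //; [right | apply: (tri' x2)].
Qed.

Definition triangle r A := [&& A \subset X, #|A| == 3 & r A <= 2].

(** Orthogonality excludes a single common element. A common triple would have rank and corank at
    most 2, hence connectivity at most 1. *)
Lemma triangle_meet r r' A A' : matroid_rank r -> matroid_rank r' ->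
  conn E r -> conn E r' -> rank_dual E r r' -> triangle r A -> triangle r' A' ->
  A :&: A' != set0 -> #|A :&: A'| = 2.
Proof.
move=> mr mr' cn cn' rr' /and3P[sA /eqP cA tA] /and3P[sA' /eqP cA' tA'].
case/set0Pn=> z; rewrite inE => /andP[zA zA'].
have zX := subsetP sA _ zA.
have cI : #|A :&: A'| <= 3 by rewrite -cA subset_leq_card ?subsetIl.
have [c3|c3] := eqVneq #|A :&: A'| 3.
  have eA : A :&: A' = A by apply/eqP; rewrite eqEcard subsetIl cA c3.
  have eA' : A :&: A' = A' by apply/eqP; rewrite eqEcard subsetIr cA' c3.
  have eAA : A' = A by rewrite -eA'.
  have sAE := subset_trans sA sX.
  have := cn A sAE _ (card_compl sX cB sA); rewrite cA => /(_ isT).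
  by have := rr' A sAE; rewrite eAA in tA'; rewrite cA; nlia.
have [c1|c1] := leqP #|A :&: A'| 1; last by move/eqP: c3; nlia.
exfalso; have eI : A :&: A' \subset [set z].
  have := cardsD1 z (A :&: A'); rewrite inE zA zA' /= => c0.
  have : #|(A :&: A') :\ z| = 0 by nlia.
  by move/eqP; rewrite cards_eq0 setD_eq0.
have i1 := triangle_in_cl sX cB cn mr sA cA tA zA.
have i2 := triangle_in_cl sX cB cn' mr' sA' cA' tA' zA'.
apply: (in_cl_dual rr' _ _ _ i2).
- by clear -sA' sX; setdec.
- exact: (subsetP sX).
- by rewrite !inE eqxx.
apply: in_cl_mono i1 => //; clear -sA sX sA' eI zA zA'; setdec.
Qed.

(* [lab r Ct A]: a triangle of r in X with an element other than f that Ct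
   allows to contract; for the dual rank, a triad with a deletable element. *)
Definition lab r Ct A := triangle r A /\ exists2 e, e \in A & e != f /\ Ct e.

(** Otherwise the two sets share two elements and form a fan of length four. *)
Lemma no_fan r r' Ct Dl A A' : ctx E X f r r' Ct Dl -> lab r Ct A ->
  triangle r' A' -> A :&: A' = set0.
Proof.
move=> h [tA labA] tA'; apply/eqP/negPn/negP => ne.
have [hr hr'] := h.
have c2 := triangle_meet (half_rank hr) (half_rank hr') (half_conn hr)
  (half_conn hr') (half_dual hr) tA tA' ne.
have [sA /eqP cA rA] := and3P tA; have [sA' /eqP cA' rA'] := and3P tA'.
have /cards2P[x2 [x3 [n23 e23]]] : #|A :&: A'| == 2 by rewrite c2.
have := cardsID A' A; rewrite c2 cA => cD.
have /cards1P[x1 e1] : #|A :\: A'| == 1 by apply/eqP; nlia.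
have := cardsID A A'; rewrite setIC c2 cA' => cD'.
have /cards1P[x4 e4] : #|A' :\: A| == 1 by apply/eqP; nlia.
have x1D : x1 \in A :\: A' by rewrite e1 inE.
have x4D : x4 \in A' :\: A by rewrite e4 inE.
have x2I : x2 \in A :&: A' by rewrite e23 !inE eqxx.
have x3I : x3 \in A :&: A' by rewrite e23 !inE eqxx orbT.
move: x1D x4D x2I x3I; rewrite !inE => /andP[a1 b1] /andP[a4 b4] /andP[a2 b2] /andP[a3 b3].
have eA : A = [set x1; x2; x3] by rewrite -(setID A A') e23 e1 setUC setUA.
have eA' : A' = [set x2; x3; x4] by rewrite -(setID A' A) setIC e23 e4.
apply: (@four_fan_lab r r' Ct Dl x1 x2 x3 x4) => //.
- rewrite /= !inE !negb_or n23 !andbT; apply/and3P; split.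
  + by apply/and3P; split; [apply: contraNneq a1 => -> | apply: contraNneq a1 => -> | apply: contraNneq a1 => ->].
  + by apply: contraNneq a4 => <-.
  + by apply: contraNneq a4 => <-.
- by clear -sA sA' eA eA'; rewrite eA in sA; rewrite eA' in sA'; setdec.
- by rewrite -eA.
- by rewrite -eA'.
- by rewrite -eA.
Qed.
End Descent.

(** * Descent on guts pairs *)

Section Descent2.
Variables (T : finType) (E X : {set T}) (f : T).
Implicit Types (r : {set T} -> nat) (A B C D F P R U V W Z : {set T})
  (a b c d e p w x y : T) (Ct Dl : T -> Prop).
Hypotheses (sX : X \subset E) (cB : 1 < #|E :\: X|).

Lemma guts_lab r Ct x W : matroid_rank r -> x \in X -> x != f -> Ct x -> W \subset X ->
  guts E r x W -> #|W| = 2 -> lab X f r Ct (x |: W).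
Proof.
move=> mr xX xf Cx sW /and5P[xE xW _ _ /and3P[s i1 i2]] c2; split; last first.
  by exists x => //; rewrite !inE eqxx.
apply/and3P; split; first by clear -xX sW; setdec.
- by rewrite cardsU1 xW c2.
- by apply: leq_trans i1 _; rewrite -c2; case: mr.
Qed.

Lemma lab_flip r r' Ct Dl A a b : ctx E X f r r' Ct Dl -> triangle X r A ->
  a \in A -> b \in A -> a != b -> b != f -> Ct a -> Dl b.
Proof.
by move=> [h _] /and3P[sA /eqP cA rA]; apply: (half_triangle h).
Qed.

Lemma pick_other A a : 1 < #|A| -> exists2 b, b \in A & b != a.
Proof.
move=> c; have : 0 < #|A :\ a|.
  by have := cardsD1 a A; case: (a \in A); clear -c; lia.
by case/card_gt0P=> b; rewrite !inE => /andP[ba bA]; exists b.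
Qed.

(** Minimality of [P] makes all of [e |: P] except [f] contractible, so [sub] can descend through
    guts pairs inside [e |: P] down to a labelled triangle; the triangle avoids [e], and its labels
    flip to [Dl]. *)
Lemma lab_in_guts r r' Ct Dl e P : ctx E X f r r' Ct Dl -> e \in X -> e != f ->
  Ct e -> P \subset X -> guts E r e P -> 2 < #|P| ->
  (forall P' : {set T}, P' \proper P -> ~~ guts E r e P') ->
  (forall A, lab X f r Ct A -> e \notin A) ->
  exists a A, [/\ a \in P, a != f, Dl a, a \in A & lab X f r Ct A].
Proof.
move=> h eX ef Ce sP gP cP minP noA.
have [hr hr'] := h; have mr := half_rank hr; have cn := half_conn hr.
have eP : e \notin P by case/and5P: gP.
have CtP p : p \in e |: P -> p != f -> Ct p.
  rewrite !inE => /orP[/eqP -> //|pP] pf.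
  have [//|[P' pr]] := half_contract hr Ce sP gP cP pP pf.
  by rewrite (negPf (minP _ pr)).
have ePX : e |: P \subset X by clear -eX sP; setdec.
have sub n : forall x W, #|W| < n -> x != f -> guts E r x W -> x |: W \subset e |: P ->
    exists a A, [/\ a \in P, a != f, Dl a, a \in A & lab X f r Ct A].
  elim: n => // n IH x W cW xf gW sW.
  have xWX := subset_trans sW ePX.
  have sWX : W \subset X by clear -xWX; setdec.
  have xX : x \in X by apply: (subsetP xWX); rewrite !inE eqxx.
  have Cx : Ct x by apply: CtP => //; apply: (subsetP sW); rewrite !inE eqxx.
  have [xE xW sWE cW1 /and3P[s i1 i2]] := and5P gW.
  have [c2|c3] := leqP #|W| 2.
    have {}c2 : #|W| = 2 by apply/eqP; rewrite eqn_leq c2.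
    have lA := guts_lab mr xX xf Cx sWX gW c2.
    have [a aW af] := pick_other f cW1.
    have eA := noA _ lA.
    exists a, (x |: W); split=> //; last by rewrite !inE aW orbT.
    + by clear -sW eA aW; rewrite !inE negb_or in eA; case/andP: eA => ex eW;
        have := subsetP sW a; rewrite !inE aW orbT => /(_ isT) /orP[/eqP ea|//]; rewrite -ea aW in eW.
    + apply: (lab_flip (a := x) h (proj1 lA)) => //.
      * by rewrite !inE eqxx.
      * by rewrite !inE aW orbT.
      * by apply: contraNneq xW => ->.
  have s2 := guts_sep_add mr gW.
  (* Either the guts pair of [p] shrinks, or it is a pair [{a, b}] with only [a] in [x |: W]. The
     one bad case is [a = f] with [b] outside [P]. *)
  have key p : p \in W -> p != f ->
      (exists a A, [/\ a \in P, a != f, Dl a, a \in A & lab X f r Ct A]) \/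
      exists b, [/\ f \in W, b \notin x |: W, b \in X, b \notin e |: P &
        r [set p; f; b] <= 2].
    move=> pW pf.
    have pX := subsetP sWX _ pW.
    have pE := subsetP sX _ pX.
    have Cp : Ct p by apply: CtP => //; apply: (subsetP sW); rewrite !inE pW orbT.
    have [R sR gR] := half_guts hr pX pf Cp.
    case: (guts_smaller mr cn sX cB xW xWX c3 s s2 pW gR sR).
      case=> Z [sZ cZ gZ]; left; apply: (IH p Z) => //; first by clear -cW cZ; lia.
      by apply: subset_trans sW; clear -sZ pW; setdec.
    case=> cR cI.
    have lA := guts_lab mr pX pf Cp sR gR cR.
    have eA := noA _ lA.
    have pR : p \notin R by case/and5P: gR.
    have iR : in_cl r p R by case/and5P: gR => _ _ _ _ /and3P[].
    have /cards1P[a ea] : #|R :&: (x |: W)| == 1 by rewrite cI.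
    have cD := cardsID (x |: W) R; rewrite cI cR in cD.
    have /cards1P[b eb] : #|R :\: (x |: W)| == 1 by apply/eqP; clear -cD; lia.
    have eR : R = [set a; b] by rewrite -(setID R (x |: W)) ea eb.
    have aI : a \in R :&: (x |: W) by rewrite ea inE.
    have bD : b \in R :\: (x |: W) by rewrite eb inE.
    move: (aI) (bD); rewrite in_setI in_setD => /andP[aR axW] /andP[bxW bR].
    have pa : a != p by apply: contraNneq pR => <-.
    have pb : b != p by apply: contraNneq pR => <-.
    have pA : p \in p |: R by rewrite !inE eqxx.
    have aA : a \in p |: R by rewrite inE aR orbT.
    have bA : b \in p |: R by rewrite inE bR orbT.
    have bX := subsetP sR _ bR.
    have [ax|ax] := eqVneq a x.
      left; apply: (IH x (W :\ p)) => //.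
      - by have := cardsD1 p W; rewrite pW; clear -cW; lia.
      - apply: guts_drop => //; first exact: (card_compl sX cB).
        apply: in_cl_mono iR => //; rewrite eR ax.
        by clear -bxW bX xX sX xW; setdec.
      - by apply: subset_trans sW; clear; setdec.
    have aW : a \in W by move: axW; rewrite !inE (negPf ax).
    have ain : a \in e |: P by apply: (subsetP sW).
    have ae : a != e by apply: contraNneq eA => <-.
    have aP : a \in P by move: ain; rewrite !inE (negPf ae).
    have [af|af] := eqVneq a f; last first.
      left; exists a, (p |: R); split=> //.
      by apply: (lab_flip h (proj1 lA) pA) => //; rewrite eq_sym.
    have [bP|bP] := boolP (b \in P).
      have bf : b != f by apply: contraNneq bxW => ->; rewrite -af.
      left; exists b, (p |: R); split=> //.
      by apply: (lab_flip h (proj1 lA) pA) => //; rewrite eq_sym.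
    right; exists b; split=> //.
    - by rewrite -af.
    - rewrite !inE negb_or bP andbT; apply: contraNneq eA => <-.
      by rewrite inE bR orbT.
    - have [_ _] := and3P (proj1 lA).
      by have -> : p |: R = [set p; f; b] by rewrite eR af setUA.
  have [p1 p1W p1f] := pick_other f cW1.
  have [p2 p2W p21] : exists2 p2, p2 \in W :\ f & p2 != p1.
    by apply: pick_other; have := cardsD1 f W; case: (f \in W); clear -c3; lia.
  move: p2W; rewrite !inE => /andP[p2f p2W].
  have [//|[b1 [fW b1W b1X b1P t1]]] := key p1 p1W p1f.
  have [//|[b2 [_ b2W b2X b2P t2]]] := key p2 p2W p2f.
  have fX := subsetP sWX _ fW.
  have [p1X p2X] : p1 \in X /\ p2 \in X by split; apply: (subsetP sWX).
  have bf b : b \notin x |: W -> b != f.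
    by apply: contraNneq => ->; rewrite inE fW orbT.
  have b1f := bf _ b1W; have b2f := bf _ b2W.
  have p2b2 : p2 != b2 by apply: contraNneq b2W => <-; rewrite inE p2W orbT.
  have p1b1 : p1 != b1 by apply: contraNneq b1W => <-; rewrite inE p1W orbT.
  (* If they agree, both triangles lie on the line through [f] and [b1], so [{p1, p2, f}] is a
     triangle inside [W]. *)
  have [b12|b12] := eqVneq b1 b2.
    rewrite -b12 in t2.
    have r2 := rank_pair sX cB cn mr fX b1X _.
    rewrite eq_sym b1f in r2; have {}r2 := r2 isT.
    have rA : r [set p1; p2; f] <= 2.
      have : r [set p1; p2; f] + r [set f; b1] <= r [set p1; f; b1] + r [set p2; f; b1].
        by apply: submod => //; clear; setdec.
      by clear -t1 t2 r2; lia.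
    have cA : #|[set p1; p2; f]| = 3.
      by apply: card3; rewrite /= !inE negb_or eq_sym p21 p1f p2f.
    have sA : [set p1; p2; f] \subset X by clear -p1X p2X fX; setdec.
    have p1A : p1 \in [set p1; p2; f] by rewrite !inE eqxx.
    have := cardsD1 p1 [set p1; p2; f]; rewrite p1A cA => cA1.
    apply: (IH p1 ([set p1; p2; f] :\ p1)) => //.
    - by clear -cA1 cW c3; lia.
    - exact: (triangle_guts sX cB).
    - by apply: subset_trans sW; clear -p1W p2W fW; setdec.
  have ib b p : p \in W -> p != f -> r [set p; f; b] <= 2 -> in_cl r b W.
    move=> pW pf t; apply: (in_cl_mono mr (A := [set p; f])); first by clear -pW fW; setdec.
    rewrite /in_cl setUC; apply: leq_trans t _.
    exact: (rank_pair sX cB cn mr (subsetP sWX _ pW) fX pf).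
  have ib1 := ib _ _ p1W p1f t1.
  have ib2 := ib _ _ p2W p2f t2.
  (* [W] spans [x], [b1] and [b2], which all lie in [E :\: W]; since [W] is 3-separating,
     submodularity leaves them rank at most 2. *)
  have rA : r [set x; b1; b2] <= 2.
    have e1 : r (b1 |: (x |: W)) <= r W.
      rewrite (in_cl_rank mr) //; by apply: in_cl_mono ib1 => //; rewrite subsetUr.
    have e2 : r (b2 |: (b1 |: (x |: W))) <= r W.
      rewrite (in_cl_rank mr) //; apply: in_cl_mono ib2 => //.
      by apply: subset_trans (subsetUr _ _); rewrite subsetUr.
    have : r E + r [set x; b1; b2] <= r (b2 |: (b1 |: (x |: W))) + r (E :\: W).
      by apply: submod => //; clear -xE xW b1W b2W b1X b2X sX sWX; setdec.
    by move: s; rewrite /sep; clear -e2; lia.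
  have [xb1 xb2] : x != b1 /\ x != b2.
    by split; [apply: contraNneq b1W => <- | apply: contraNneq b2W => <-]; rewrite !inE eqxx.
  have un : uniq [:: x; b1; b2] by rewrite /= !inE negb_or xb1 xb2 b12.
  have tA : triangle X r [set x; b1; b2].
    apply/and3P; split=> //; first by clear -xX b1X b2X; setdec.
    by rewrite card3.
  have xA : x \in [set x; b1; b2] by rewrite !inE eqxx.
  have lA : lab X f r Ct [set x; b1; b2] by split=> //; exists x.
  have ex : x != e by apply: contraNneq (noA _ lA) => <-.
  have xP : x \in P.
    by have := subsetP sW x; rewrite !inE eqxx (negPf ex) => /(_ isT).
  have [sA /eqP cA _] := and3P tA.
  have ix := triangle_in_cl sX cB cn mr sA cA rA xA.
  have pr : P :\ x \proper P by rewrite properD1.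
  have /negP[] := minP _ pr.
  apply: guts_drop => //; first exact: (card_compl sX cB).
  by apply: in_cl_mono ix => //; clear -b1P b2P b1X b2X sX; setdec.
exact: (sub #|P|.+1 e P).
Qed.

(** The alternating descent: [lab_in_guts] provides a deletable [a] in [P] on a labelled triangle,
    which is the dual of the situation of [e], and [a] has a guts pair smaller than [P]. *)
Lemma no_lab_guts n r r' Ct Dl e P A' : ctx E X f r r' Ct Dl -> #|P| < n ->
  e \in X -> e != f -> Ct e -> P \subset X -> guts E r e P ->
  lab X f r' Dl A' -> e \in A' -> False.
Proof.
elim: n r r' Ct Dl e P A' => // n IH r r' Ct Dl e P A' h cn eX ef Ce sP gP lA' eA'.
have [hr hr'] := h.
have mr := half_rank hr; have mr' := half_rank hr'; have rr' := half_dual hr.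
have noA A : lab X f r Ct A -> e \notin A.
  move=> lA; apply/negP => eA.
  have := no_fan sX cB h lA (proj1 lA').
  by move/setP/(_ e); rewrite !inE eA eA'.
have [eE eP sPE cP /and3P[s i1 i2]] := and5P gP.
have [c2|c3] := leqP #|P| 2.
  have {}c2 : #|P| = 2 by apply/eqP; rewrite eqn_leq c2.
  have := noA _ (guts_lab mr eX ef Ce sP gP c2).
  by rewrite !inE eqxx.
have minP : forall P' : {set T}, P' \proper P -> ~~ guts E r e P'.
  move=> P' pr; apply/negP => gP'.
  apply: (IH _ _ _ _ _ _ _ h _ eX ef Ce _ gP' lA' eA').
    by have := proper_card pr; clear -cn; lia.
  exact: subset_trans (proper_sub pr) sP.
have [a [A [aP af Da aA lA]]] := lab_in_guts h eX ef Ce sP gP c3 minP noA.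
have aX := subsetP sP _ aP.
have [R sR gR] := half_guts hr' aX af Da.
have cR : #|P| <= #|R|.
  rewrite leqNgt; apply/negP => cR.
  by apply: (IH _ _ _ _ _ _ _ (ctxC h) _ aX af Da sR gR lA aA); clear -cn cR; lia.
have ePX : e |: P \subset X by clear -eX sP; setdec.
have s1 : sep E r' P by rewrite (sep_dual mr rr').
have s2 : sep E r' (e |: P).
  by rewrite (sep_dual mr rr') ?(subset_trans ePX sX) //; apply: guts_sep_add.
case: (guts_smaller mr' (half_conn hr') sX cB eP ePX c3 s1 s2 aP gR sR).
  case=> Z [sZ cZ gZ].
  apply: (IH _ _ _ _ _ _ _ (ctxC h) _ aX af Da _ gZ lA aA); first by clear -cn cZ; lia.
  by clear -sZ ePX; setdec.
by case=> c2 _; clear -c2 c3 cR; lia.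
Qed.

(** The first descent passes to a smaller guts pair of [e] or of some [p] in [P]. At size two it
    reaches a labelled triangle with a deletable element, which [no_lab_guts] forbids. *)
Lemma no_guts n r r' Ct Dl e P : ctx E X f r r' Ct Dl -> #|P| < n ->
  e \in X -> e != f -> Ct e -> P \subset X -> guts E r e P -> False.
Proof.
move=> h; have [hr hr'] := h; have mr := half_rank hr.
elim: n e P => // n IH e P cn eX ef Ce sP gP.
have [eE eP sPE cP /and3P[s i1 i2]] := and5P gP.
have ePX : e |: P \subset X by clear -eX sP; setdec.
have [p pP pf] := pick_other f cP.
have pX := subsetP sP _ pP.
have [c2|c3] := leqP #|P| 2.
  have {}c2 : #|P| = 2 by apply/eqP; rewrite eqn_leq c2.
  have lA := guts_lab mr eX ef Ce sP gP c2.
  have pA : p \in e |: P by rewrite inE pP orbT.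
  have Dp : Dl p.
    apply: (lab_flip (a := e) h (proj1 lA)) => //; first by rewrite !inE eqxx.
    by apply: contraNneq eP => ->.
  have [R sR gR] := half_guts hr' pX pf Dp.
  exact: (no_lab_guts (ctxC h) (ltnSn _) pX pf Dp sR gR lA pA).
case: (half_contract hr Ce sP gP c3 pP pf) => [Cp|[P' pr gP']]; last first.
  apply: (IH e P') => //; first by have := proper_card pr; clear -cn; lia.
  exact: subset_trans (proper_sub pr) sP.
have [R sR gR] := half_guts hr pX pf Cp.
case: (guts_smaller mr (half_conn hr) sX cB eP ePX c3 s (guts_sep_add mr gP) pP gR sR).
  case=> Z [sZ cZ gZ]; apply: (IH p Z) => //; first by clear -cn cZ; lia.
  by clear -sZ ePX; setdec.
by case=> c2 _; apply: (IH p R) => //; clear -c2 c3 cn; lia.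
Qed.

Lemma ctx_absurd r r' Ct Dl e : ctx E X f r r' Ct Dl -> e \in X -> e != f ->
  Ct e \/ Dl e -> False.
Proof.
move=> h eX ef; have [hr hr'] := h.
case=> he.
  have [P sP gP] := half_guts hr eX ef he.
  exact: (no_guts h (ltnSn _) eX ef he sP gP).
have [P sP gP] := half_guts hr' eX ef he.
exact: (no_guts (ctxC h) (ltnSn _) eX ef he sP gP).
Qed.
End Descent2.

(** * Keeping the minor N *)

Section Linking.
Variables (T : finType) (r : {set T} -> nat).
Implicit Types (A B C D E Q R U Y : {set T}) (e f p x : T).
Hypothesis mr : matroid_rank r.

(* Tutte's linking theorem between Q and the single element f. *)
Lemma linking n Q f C R : #|R| < n ->
  (forall U, U \subset R -> r (Q :|: R :|: (f |: C)) + r C < 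
     r (U :|: (f |: C)) + r (Q :|: (R :\: U) :|: C)) ->
  exists C', [/\ C' \subset R, ~~ in_cl r f (C' :|: C) & in_cl r f (Q :|: (C' :|: C))].
Proof.
elim: n C R => // n IH C R cR lk.
have [R0|[x xR]] := set_0Vmem R.
  exists set0; have := lk set0; rewrite R0 !sub0set !set0U setD0 !setU0 => /(_ isT) h.
  split=> //; rewrite /in_cl.
    rewrite -ltnNge; have : r (Q :|: C) <= r (Q :|: (f |: C)).
      by apply: rank_mono => //; setdec.
    by clear -h; lia.
  have -> : f |: (Q :|: C) = Q :|: (f |: C) by setdec.
  by have := rank_le1 f C mr; clear -h; lia.
have cRx : #|R :\ x| < n by have := cardsD1 x R; rewrite xR; clear -cR; lia.
(* Try deleting [x], then contracting it. If [U1] and [U2] obstruct the two choices, submodularity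
   contradicts the hypothesis for [U1 :&: U2] and [x |: (U1 :|: U2)] taken together. *)
have [/forall_inP h1|/forall_inPn [U1 sU1 h1]] :=
  boolP [forall (U : {set T} | U \subset R :\ x),
     r (Q :|: (R :\ x) :|: (f |: C)) + r C <
     r (U :|: (f |: C)) + r (Q :|: ((R :\ x) :\: U) :|: C)].
  have [C' [sC' a1 a2]] := IH C (R :\ x) cRx h1.
  by exists C'; split=> //; apply: subset_trans sC' _; rewrite subD1set.
have [/forall_inP h2|/forall_inPn [U2 sU2 h2]] :=
  boolP [forall (U : {set T} | U \subset R :\ x),
     r (Q :|: (R :\ x) :|: (f |: (x |: C))) + r (x |: C) <
     r (U :|: (f |: (x |: C))) + r (Q :|: ((R :\ x) :\: U) :|: (x |: C))].
  have [C' [sC' a1 a2]] := IH (x |: C) (R :\ x) cRx h2.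
  exists (x |: C'); have -> : x |: C' :|: C = C' :|: (x |: C) by clear; setdec.
  by split=> //; clear -sC' xR; setdec.
exfalso; rewrite -!leqNgt in h1 h2.
have {}sU1 : U1 \subset R :\ x := sU1; have {}sU2 : U2 \subset R :\ x := sU2.
have sU12 : U1 :&: U2 \subset R by clear -sU1; setdec.
have sxU : x |: (U1 :|: U2) \subset R by clear -sU1 sU2 xR; setdec.
have k1 := lk _ sU12; have k2 := lk _ sxU.
have s1 : r (x |: (U1 :|: U2) :|: (f |: C)) + r (U1 :&: U2 :|: (f |: C)) <=
   r (U1 :|: (f |: C)) + r (U2 :|: (f |: (x |: C))).
  by apply: submod => //; clear; setdec.
have s2 : r (Q :|: (R :\: (U1 :&: U2)) :|: C) +
    r (Q :|: (R :\: (x |: (U1 :|: U2))) :|: C) <=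
   r (Q :|: ((R :\ x) :\: U1) :|: C) + r (Q :|: ((R :\ x) :\: U2) :|: (x |: C)).
  by apply: submod => //; clear; setdec.
have m1 : r (Q :|: (R :\ x) :|: (f |: C)) <= r (Q :|: R :|: (f |: C)).
  by apply: rank_mono => //; clear; setdec.
have m2 : r (Q :|: (R :\ x) :|: (f |: (x |: C))) <= r (Q :|: R :|: (f |: C)).
  by apply: rank_mono => //; clear -xR; setdec.
have m3 := rank_le1 x C mr.
by clear -h1 h2 k1 k2 s1 s2 m1 m2 m3; lia.
Qed.

(* Contracting A and contracting A' induce the same matroid on Q. *)
Definition same_contr Q A A' := forall Y, Y \subset Q ->
  r (Y :|: A) + r A' = r (Y :|: A') + r A.

Lemma same_contr_sym Q A A' : same_contr Q A A' -> same_contr Q A' A.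
Proof. by move=> h Y /h ->. Qed.

Lemma same_contr_trans Q A B C : same_contr Q A B -> same_contr Q B C -> same_contr Q A C.
Proof. by move=> h1 h2 Y sY; have := h1 _ sY; have := h2 _ sY; lia. Qed.

(** The gap [r (Y :|: A') - r (Y :|: A)] can only shrink as [Y] grows, so its value at [set0] and
    the bound at [Q] fix it in between. *)
Lemma same_contr_sub Q A A' : A \subset A' ->
  r (Q :|: A) + r A' <= r (Q :|: A') + r A -> same_contr Q A A'.
Proof.
move=> sA h Y sY; apply/eqP; rewrite eqn_leq; apply/andP; split; last first.
  by rewrite [X in _ <= X]addnC; apply: submod => //; clear -sA; setdec.
have : r (Q :|: A') + r (Y :|: A) <= r (Q :|: A) + r (Y :|: A').
  by apply: submod => //; clear -sA sY; setdec.
by clear -h; lia.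
Qed.

End Linking.

Section Minor.
Variables (T : finType) (E X G : {set T}) (f : T) (r rN : {set T} -> nat).
Implicit Types (A B C D P Q R U Y : {set T}) (e p x : T).

(* N = M / C \ (E - G - C), where G is the ground set of N and rN its rank. *)
Definition contr_set C :=
  C \subset E :\: G /\ forall Y, Y \subset G -> r (Y :|: C) = rN Y + r C.
Definition contractible e := exists2 C, contr_set C & e \in C.
Definition deletable e := exists2 C, contr_set C & e \in (E :\: G) :\: C.

Hypotheses (mr : matroid_rank r) (cn : conn E r) (sX : X \subset E)
  (cB : 1 < #|E :\: X|) (sG : G \subset E)
  (XG : X :&: G \subset [set f]) (noloop : forall g, g \in G -> 0 < rN [set g])
  (nocoloop : forall g, g \in G -> rN G <= rN (G :\ g)).

(** If [b] is contracted along with [a], the third element [c] becomes a loop, hence is not in [G].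
    Trading [b] for [c] in the contracted set keeps its closure. *)
Lemma contractible_triangle A a b : A \subset X -> #|A| = 3 -> r A <= 2 ->
  a \in A -> b \in A -> a != b -> b != f -> contractible a -> deletable b.
Proof.
move=> sA cA rA aA bA ab bf [C [sC rC] aC].
have bE : b \in E :\: G.
  have bX := subsetP sA _ bA; rewrite inE (subsetP sX) // andbT.
  by apply: contra bf => bG; have := subsetP XG b; rewrite !inE bX bG => /(_ isT).
have [bC|bC] := boolP (b \in C); last by exists C; rewrite // inE bC.
have aD : a \in A :\ b by rewrite !inE ab aA.
have /cards1P[c ec] : #|A :\ b :\ a| == 1.
  have := cardsD1 b A; have := cardsD1 a (A :\ b).
  by rewrite aD bA cA; clear; lia.
have cD : c \in A :\ b :\ a by rewrite ec inE.
move: (cD); rewrite !inE => /and3P[ca cb cAA].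
have cE : c \in E by apply: (subsetP sX); apply: (subsetP sA).
have eA : A = [set a; b; c].
  rewrite -(setD1K bA) -(setD1K aD) ec; clear; setdec.
have ic : in_cl r c C.
  apply: in_cl_mono (triangle_in_cl sX cB cn mr sA cA rA cAA) => //.
  by rewrite eA; clear -aC bC; setdec.
have cG : c \notin G.
  apply/negP => cG; have := rC [set c]; rewrite sub1set cG => /(_ isT).
  by move: ic (noloop cG); rewrite /in_cl; clear; lia.
have ib : in_cl r b (c |: (C :\ b)).
  apply: in_cl_mono (triangle_in_cl sX cB cn mr sA cA rA bA) => //.
  by rewrite eA; clear -aC ab; setdec.
have eqr Y : r (Y :|: (c |: (C :\ b))) = r (Y :|: C).
  have i1 : in_cl r b (Y :|: (c |: (C :\ b))).
    by apply: in_cl_mono ib => //; rewrite subsetUr.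
  have i2 : in_cl r c (Y :|: C) by apply: in_cl_mono ic => //; rewrite subsetUr.
  rewrite -(in_cl_rank mr i1) -(in_cl_rank mr i2); congr (r _).
  by clear -bC cb; setdec.
exists (c |: (C :\ b)); last by rewrite in_setD bE !inE eqxx eq_sym (negPf cb).
split; first by clear -sC cE cG; setdec.
move=> Y sY; rewrite eqr rC //; congr (_ + _).
by rewrite -[C in LHS]set0U -eqr set0U.
Qed.

(** In [M / e] the connectivity between [P] and the rest [Q] is at most 1, so contracting a subset
    of [e |: P] through [e] affects [Q] either like [e] or like all of [e |: P]. Hence the part of
    [C] in [e |: P] may be exchanged for one containing [p]; if [f] is in both [N] and [P], linking
    is needed to preserve [f] too. *)
Lemma contractible_guts e P p : contractible e -> P \subset X -> guts E r e P ->
  2 < #|P| -> p \in P -> p != f ->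
  contractible p \/ exists2 P' : {set T}, P' \proper P & guts E r e P'.
Proof.
move=> [C [sC rC] eC] sP gP cP pP pf.
have [eE eP sPE _ /and3P[s i1 i2]] := and5P gP.
have [pC|pC] := boolP (p \in C); first by left; exists C.
have cEP := card_compl sX cB sP.
have [ip|ip] := boolP (in_cl r p (E :\: P)).
  by right; exists (P :\ p); [rewrite properD1 | apply: guts_drop].
set Q := E :\: (e |: P).
have eQ : e |: Q = E :\: P by rewrite /Q; clear -eE eP; setdec.
have pe : p != e by apply: contraNneq eP => <-.
have pE := subsetP sPE _ pP.
have eG : e \notin G by have := subsetP sC _ eC; rewrite !inE => /andP[].
have re : 0 < r [set e].
  have c2 : #|[set p; e]| = 2 by rewrite cards2 pe.
  have := @cn [set p; e]; rewrite c2.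
  have -> : [set p; e] \subset E by clear -pE eE; setdec.
  have -> : 1 < #|E :\: [set p; e]|.
    have c1 : 1 < #|P :\ p| by have := cardsD1 p P; rewrite pP; clear -cP; lia.
    by apply: leq_trans c1 _; apply: subset_leq_card; clear -sPE eP; setdec.
  move=> /(_ isT isT isT); have := rank_le1 p [set e] mr.
  have : r (E :\: [set p; e]) <= r E by apply: rank_mono => //; clear; setdec.
  by clear; lia.
have l1 : r (e |: P) + r (e |: Q) <= r E + 2.
  rewrite eQ; move: s i1; rewrite /sep /in_cl; clear; lia.
have QeP : Q :|: (e |: P) = E by rewrite /Q; clear -eE sPE; setdec.
set CQ := C :\: (e |: P).
set A := C :&: (e |: P).
have CE : C \subset E by clear -sC; setdec.
have eCA : C = CQ :|: A by rewrite /CQ /A; clear; setdec.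
have sCQ : CQ \subset Q by rewrite /CQ /Q; clear -CE; setdec.
have eA : e \in A by rewrite !inE eC eqxx.
have sA : A \subset e |: P by apply: subsetIr.
have swap A' : A' \subset e |: P -> same_contr r Q A A' ->
    forall Y, Y \subset Q -> r (Y :|: C) + r (CQ :|: A') = r (Y :|: (CQ :|: A')) + r C.
  move=> sA' sm Y sY; rewrite eCA.
  have := sm CQ sCQ; have := sm (Y :|: CQ); rewrite subUset sY sCQ => /(_ isT).
  rewrite !setUA; clear; lia.
have sim1 A' : e \in A' -> r A' + r (e |: Q) <= r (Q :|: A') + 1 ->
    same_contr r Q [set e] A'.
  move=> eA' h; apply: same_contr_sub => //; first by rewrite sub1set.
  by rewrite setUC; clear -h re; lia.
have [/andP[fP fG]|nf] := boolP ((f \in P) && (f \in G)); last first.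
  have GQ : G \subset Q.
    apply/subsetP => g gG; rewrite !inE (subsetP sG) // andbT negb_or.
    have -> /= : g != e by apply: contraNneq eG => <-.
    apply/negP => gP'; case/negP: nf; have := subsetP XG g.
    by rewrite !inE gG (subsetP sP) // => /(_ isT) /eqP <-; rewrite gG gP'.
  have GP : G :&: P \subset set0 by apply: subset_trans (setSI P GQ) _; rewrite /Q; clear; setdec.
  have finish A' : p \in A' -> A' \subset e |: P -> same_contr r Q A A' -> contractible p.
    move=> pA' sA' sm; exists (CQ :|: A'); last by rewrite inE pA' orbT.
    split.
      rewrite subUset; apply/andP; split.
        by apply: subset_trans sC; apply: subsetDl.
      clear -sA' sPE eE GP eG; setdec.
    move=> Y sY; have sYQ := subset_trans sY GQ.
    by have := swap A' sA' sm Y sYQ; rewrite rC //; clear; lia.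
  (* Either [A] acts like [e], and so does [{e, p}] because [e |: Q] does not span [p], or [A] acts
     like [e |: P]. *)
  left; have [c0|c1] := leqP (r A + r (e |: Q)) (r (Q :|: A) + 1).
    apply: (finish [set e; p]).
    - by rewrite !inE eqxx orbT.
    - by clear -pP; setdec.
    apply: same_contr_trans (same_contr_sym (sim1 A eA c0)) _.
    apply: same_contr_sub => //; first by rewrite subsetUl.
    move: ip; rewrite -eQ /in_cl -ltnNge => ip.
    have -> : Q :|: [set e; p] = p |: (e |: Q) by clear; setdec.
    have -> : Q :|: [set e] = e |: Q by rewrite setUC.
    have := rank_le1 p [set e] mr; rewrite setUC; clear -ip; lia.
  apply: (finish (e |: P)).
  - by rewrite inE pP orbT.
  - by [].
  apply: same_contr_sub => //; rewrite QeP; clear -c1 l1; lia.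
have ef : e != f by apply: contraNneq eP => ->.
have GfQ : G :\ f \subset Q.
  apply/subsetP => g; rewrite !inE => /andP[gf gG]; rewrite (subsetP sG) // andbT negb_or.
  have -> /= : g != e by apply: contraNneq eG => <-.
  apply: contra gf => gP'; have := subsetP XG g.
  by rewrite !inE gG (subsetP sP) // => /(_ isT).
have GCf : G :&: C \subset set0 by clear -sC; setdec.
(* If contracting [A'] makes [f] neither a loop nor a coloop on [f |: Q], then [A'] acts on [Q] like
   [e], and [f |: A'] like [e |: P]. So all such [A'] induce the same matroid on [f |: Q]. *)
have normal A' : e \in A' -> A' \subset e |: P -> ~~ in_cl r f A' -> in_cl r f (Q :|: A') ->
    [/\ same_contr r Q [set e] A', same_contr r Q (f |: A') (e |: P) & r (f |: A') = (r A').+1].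
  move=> eA' sA' n1 n2.
  have rf : r (f |: A') = (r A').+1.
    move: n1; rewrite /in_cl -ltnNge; have := rank_le1 f A' mr; clear; lia.
  have h1 : r E + r (f |: A') <= r (e |: P) + r (Q :|: (f |: A')).
    apply: submod => //; first by rewrite -QeP; clear; setdec.
    by clear -sA' fP; setdec.
  have h2 : r (Q :|: (f |: A')) <= r (Q :|: A').
    by have -> : Q :|: (f |: A') = f |: (Q :|: A') by clear; setdec.
  have h3 : r (Q :|: A') + r [set e] <= r (e |: Q) + r A'.
    by apply: submod => //; clear -eA'; setdec.
  split=> //.
    by apply: sim1 => //; clear -h1 h2 l1 rf; lia.
  apply: same_contr_sub; first by [].
    by clear -sA' fP; setdec.
  by rewrite QeP; clear -h2 h3 rf l1 re; lia.
(* [A] qualifies, as [f] is neither a loop nor a coloop of [N]. *)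
have n1 : ~~ in_cl r f A.
  apply/negP => /(in_cl_mono mr (subsetIl C (e |: P))).
  have := rC [set f]; rewrite sub1set fG => /(_ isT); rewrite /in_cl.
  by have := noloop fG; clear; lia.
have n2 : in_cl r f (Q :|: A).
  apply: (in_cl_mono mr (A := (G :\ f) :|: C)).
    rewrite subUset; apply/andP; split; first by apply: subset_trans GfQ _; apply: subsetUl.
    by move: (setSU A sCQ); rewrite -eCA.
  rewrite /in_cl setUA setD1K // !rC ?subD1set // leq_add2r.
  exact: nocoloop.
have [sm1 sm2 rfA] := normal A eA sA n1 n2.
set C0 := [set e; p]; set R := P :\ p :\ f.
(* Both [e] and [p] must be contracted, whence [C0]. A set [U] that obstructs linking yields a
   smaller guts pair of [e]. *)
have [/forall_inP lk|/forall_inPn [U sU nlk]] :=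
  boolP [forall (U : {set T} | U \subset R),
     r (Q :|: R :|: (f |: C0)) + r C0 <
     r (U :|: (f |: C0)) + r (Q :|: (R :\: U) :|: C0)].
  left; have [C' [sC' m1 m2]] := linking mr (ltnSn _) lk.
  have sA' : C' :|: C0 \subset e |: P by rewrite /C0; rewrite /R in sC'; clear -sC' pP; setdec.
  have eA' : e \in C' :|: C0 by rewrite !inE eqxx orbT.
  have fA' : f \notin C' :|: C0.
    rewrite !inE !negb_or eq_sym ef eq_sym pf !andbT.
    by apply/negP => /(subsetP sC'); rewrite !inE eqxx.
  have [sm1' sm2' rfA'] := normal _ eA' sA' m1 m2.
  have smA := same_contr_trans (same_contr_sym sm1) sm1'.
  have smf := same_contr_trans sm2 (same_contr_sym sm2').
  exists (CQ :|: (C' :|: C0)); last by rewrite !inE eqxx !orbT.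
  split.
    rewrite subUset; apply/andP; split; first by apply: subset_trans sC; apply: subsetDl.
    apply/subsetP => z zA'; rewrite !inE.
    have zE : z \in E by move: (subsetP sA' _ zA'); rewrite !inE => /orP[/eqP-> //|]; apply: (subsetP sPE).
    rewrite zE andbT; apply/negP => zG.
    have zf : z != f by apply: contraNneq fA' => <-.
    have : z \in Q by apply: (subsetP GfQ); rewrite !inE zf zG.
    by rewrite inE (subsetP sA').
  move=> Y sY; have [fY|fY] := boolP (f \in Y); last first.
    have sYQ : Y \subset Q by apply: subset_trans GfQ; clear -sY fY; setdec.
    by have := swap _ sA' smA Y sYQ; rewrite rC //; clear; lia.
  have sYQ : Y :\ f \subset Q by apply: subset_trans GfQ; apply: setSD.
  have h1 := smA CQ sCQ.
  have h2 := smf (Y :\ f :|: CQ); rewrite subUset sYQ sCQ in h2.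
  have {}h2 := h2 isT.
  have e1 : Y :\ f :|: CQ :|: (f |: A) = Y :|: C.
    by rewrite [in RHS]eCA -{2}(setD1K fY); clear; setdec.
  have e2 : Y :\ f :|: CQ :|: (f |: (C' :|: C0)) = Y :|: (CQ :|: (C' :|: C0)).
    by rewrite -{2}(setD1K fY); clear; setdec.
  rewrite e1 e2 rC // rfA rfA' in h2; rewrite -eCA in h1.
  by clear -h1 h2; lia.
right; rewrite -leqNgt in nlk; have {}sU : U \subset R := sU.
have fE := subsetP sPE _ fP.
have pX := subsetP sP _ pP; have fX := subsetP sP _ fP.
have nle : r (U :|: (f |: C0)) + r (Q :|: (R :\: U) :|: C0) <= r E + 2.
  apply: leq_trans nlk _; apply: leq_add.
    by apply: rank_mono => //; rewrite /Q /R /C0; clear -eE pE fE sPE; setdec.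
  case: mr => h _ _; apply: leq_trans (h _) _; rewrite cards2; by case: (_ != _).
have eE2 : Q :|: (R :\: U) :|: C0 = E :\: (f |: U).
  by rewrite /R in sU; rewrite /Q /R /C0; clear -sU eE pE sPE eP ef pf pP fP; setdec.
rewrite eE2 in nle.
have [c2|c1] := ltnP 1 #|f |: U|.
  have fUP : f |: U \subset P by rewrite /R in sU; clear -sU fP; setdec.
  have := cn (subset_trans fUP sPE) c2 (card_compl sX cB (subset_trans fUP sP)).
  move=> hc; exists (f |: U).
    apply/properP; split=> //; exists p => //.
    by rewrite !inE negb_or pf; apply/negP => /(subsetP sU); rewrite !inE eqxx andbF.
  have m1 : r (f |: U) <= r (U :|: (f |: C0)) by apply: rank_mono => //; clear; setdec.
  have m2 : r (e |: (f |: U)) <= r (U :|: (f |: C0)).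
    by apply: rank_mono => //; rewrite /C0; clear; setdec.
  rewrite /guts eE (subset_trans fUP sPE) c2 /=.
  have -> /= : e \notin f |: U by apply: contra eP => /(subsetP fUP).
  apply/and3P; split.
  - by rewrite /sep; clear -nle m1; lia.
  - by rewrite /in_cl; clear -nle m2 hc; lia.
  - by apply: in_cl_mono i2 => //; clear -fUP; setdec.
(* A singleton is too small for a guts pair, but now [{e, f, p}] has rank 2 and [{f, p}] serves
   instead. *)
have eU : f |: U = [set f].
  by apply/eqP; rewrite eq_sym eqEcard cards1 c1 sub1set !inE eqxx.
have fpP : [set f; p] \subset P by clear -fP pP; setdec.
have fp : f != p by rewrite eq_sym.
have c2 : #|[set f; p]| = 2 by rewrite cards2 fp.
have rfp := rank_pair sX cB cn mr fX pX fp.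
have hc := @cn [set f; p]; rewrite c2 in hc.
have {}hc := hc (subset_trans fpP sPE) isT (card_compl sX cB (subset_trans fpP sP)).
have rfp2 : r [set f; p] <= 2 by rewrite -c2; case: mr.
have m1 : r (E :\: [set f; p]) <= r (E :\: (f |: U)).
  by apply: rank_mono => //; rewrite eU; clear; setdec.
have m2 : r (e |: [set f; p]) <= r (U :|: (f |: C0)).
  by apply: rank_mono => //; rewrite /C0; clear; setdec.
exists [set f; p].
  by rewrite properEcard fpP c2 cP.
rewrite /guts eE (subset_trans fpP sPE) c2 /=.
have -> /= : e \notin [set f; p] by apply: contra eP => /(subsetP fpP).
apply/and3P; split.
- by apply: rank_le2_sep.
- by rewrite /in_cl; clear -nle m1 m2 hc rfp rfp2; lia.
- by apply: in_cl_mono i2 => //; clear -fpP; setdec.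
Qed.
End Minor.

(** * Guts pairs from the tangle *)

Section Tangle.
Variables (T : finType) (E X : {set T}) (Tg : {set {set T}}).
Implicit Types (r : {set T} -> nat) (A B C P Q : {set T}) (e : T).

(** 3-connectivity of [M / e], whose rank is [r (e |: A) - r [set e]], cleared of subtraction. *)
Definition conn_contract r e := forall k P, k < 3 -> P \subset E :\ e ->
  k <= #|P| -> k <= #|(E :\ e) :\: P| ->
  r E + r [set e] + k <= r (e |: P) + r (e |: ((E :\ e) :\: P)).

Hypotheses (sX : X \subset E) (cB : 1 < #|E :\: X|) (cX : 2 < #|X|)
  (XT : X \in Tg)
  (tangle3 : forall A B C, A \in Tg -> B \in Tg -> C \in Tg -> A :|: B :|: C != E)
  (tangle1 : forall e, e \in E -> E :\ e \notin Tg).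

(** Both sides of a 2-separation of [M / e] form guts pairs with [e]. The tangle contains one side
    together with [e], as otherwise both sides and [{e}] would be members covering [E]. Uncrossing
    with the maximal member [X] puts that side inside [X]. *)
Lemma conn_contract_or_guts r e : matroid_rank r -> conn E r ->
  (forall A, A \subset E -> sep E r A -> A \in Tg \/ E :\: A \in Tg) ->
  sep E r X -> (forall Y, Y \in Tg -> X \subset Y -> sep E r Y -> Y \subset X) ->
  e \in X -> conn_contract r e \/ exists2 P : {set T}, P \subset X & guts E r e P.
Proof.
move=> mr cn tg sepX maxX eX.
have [/exists_inP[P sP gP]|noP] := boolP [exists (P : {set T} | P \subset X), guts E r e P].
  by right; exists P.
left=> k P kle sP kP kQ; set Q := (E :\ e) :\: P.
have {}noP P' : P' \subset X -> ~~ guts E r e P'.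
  by move=> sP'; apply: contra noP => gP'; apply/exists_inP; exists P'.
have eE := subsetP sX _ eX.
have eP : e \notin P by apply/negP => /(subsetP sP); rewrite !inE eqxx.
have PE : P \subset E by clear -sP; setdec.
have QE : Q \subset E by rewrite /Q; clear; setdec.
have eQ : e \notin Q by rewrite /Q; clear; setdec.
have EP : E :\: (e |: P) = Q by rewrite /Q; clear; setdec.
have EQ : E :\: (e |: Q) = P by rewrite /Q; clear -sP; setdec.
have EPc : E :\: P = e |: Q by rewrite /Q; clear -eE eP; setdec.
have EQc : E :\: Q = e |: P by rewrite /Q; clear -eE sP; setdec.
have ePE : e |: P \subset E by clear -eE PE; setdec.
have eQE : e |: Q \subset E by clear -eE QE; setdec.
have re1 : r [set e] <= 1 by rewrite -(cards1 e); case: mr.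
have cPQ : #|P| + #|Q| + 1 = #|E|.
  have := cardsID P E; have -> : E :&: P = P by clear -PE; setdec.
  by rewrite EPc cardsU1 eQ; clear; lia.
have cE5 : 4 < #|E|.
  have := cardsID X E; have -> : E :&: X = X by clear -sX; setdec.
  by clear -cX cB; lia.
have cP1 : #|e |: P| = #|P|.+1 by rewrite cardsU1 eP.
have cQ1 : #|e |: Q| = #|Q|.+1 by rewrite cardsU1 eQ.
have mP : r P <= r (e |: P) by apply: rank_mono => //; rewrite subsetUr.
have mQ : r Q <= r (e |: Q) by apply: rank_mono => //; rewrite subsetUr.
case: k kle kP kQ => [|k] kle kP kQ.
  have : r E + r [set e] <= r (e |: P) + r (e |: Q).
    by apply: submod => //; rewrite /Q; clear; setdec.
  by rewrite addn0.
have half P1 P2 : E :\: (e |: P1) = P2 -> e |: P1 \subset E -> #|e |: P1| = #|P1|.+1 ->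
    0 < #|P1| -> 1 < #|P2| -> r E + 2 <= r (e |: P1) + r P2.
  by move=> <- s1 c1 c2 c3; apply: cn => //; rewrite c1.
case: k kle kP kQ => [|k] kle kP kQ.
  have [c2|c1] := ltnP 1 #|Q|.
    by have := half P Q EP ePE cP1 kP c2; clear -re1 mP mQ; lia.
  have c2 : 1 < #|P| by clear -cPQ c1 cE5; lia.
  by have := half Q P EQ eQE cQ1 kQ c2; clear -re1 mP mQ; lia.
case: k kle kP kQ => [|//] _ kP kQ.
have h1 := half P Q EP ePE cP1 (ltnW kP) kQ.
have h2 := half Q P EQ eQE cQ1 (ltnW kQ) kP.
rewrite leqNgt; apply/negP => lt.
have gP : guts E r e P.
  rewrite /guts eE eP PE /sep /in_cl EP EPc /=; apply/and4P; split=> //;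
    clear -h1 h2 lt re1 mP mQ kP kQ; lia.
have gQ : guts E r e Q.
  rewrite /guts eE eQ QE /sep /in_cl EQ EQc /=; apply/and4P; split=> //;
    clear -h1 h2 lt re1 mP mQ kP kQ; lia.
(* whichever of the two sides, together with e, lies in the tangle yields a
   guts pair inside X *)
have side P1 : P1 \subset E -> e |: P1 \in Tg -> guts E r e P1 -> False.
  move=> P1E TP gP1; have [_ eP1 _ cP' /and3P[s i1 i2]] := and5P gP1.
  have s2 := guts_sep_add mr gP1.
  have eP1E : e |: P1 \subset E by clear -eE P1E; setdec.
  have [c1|c1] := leqP #|X :&: (e |: P1)| 1.
    have XP : X :&: P1 \subset set0.
      have := cardsD1 e (X :&: (e |: P1)); rewrite !inE eX eqxx /= => c2.
      have /eqP : #|(X :&: (e |: P1)) :\ e| = 0 by clear -c1 c2; lia.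
      rewrite cards_eq0 -subset0 => h0; clear -h0 eP1; setdec.
    have cX1 : 1 < #|X :\ e| by have := cardsD1 e X; rewrite eX; clear -cX; lia.
    have /negP[] := noP (X :\ e) (subD1set _ _).
    apply: guts_add => //.
    - by rewrite !inE eqxx.
    - by clear -sX; setdec.
    - by apply: (card_compl sX cB); rewrite subD1set.
    - by rewrite setD1K.
    - by apply: in_cl_mono i1 => //; rewrite setD1K //; clear -XP P1E; setdec.
  (* [uncross] bounds intersections, so the union is reached through complements. *)
  have sI : sep E r (X :|: (e |: P1)).
    have XE : E :\: X \subset E by apply: subsetDl.
    have PE1 : E :\: (e |: P1) \subset E by apply: subsetDl.
    have UE : X :|: (e |: P1) \subset E by clear -sX eP1E; setdec.
    rewrite -(sep_compl r UE) setDUr; apply: uncross => //.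
    - by rewrite sep_compl.
    - by rewrite sep_compl.
    - by rewrite -setDIr; apply: (card_compl sX cB); apply: subsetIl.
    - rewrite -setDIr; have -> : E :\: (E :\: (X :&: (e |: P1))) = X :&: (e |: P1).
        by clear -sX; setdec.
      by [].
  have UE : X :|: (e |: P1) \subset E by clear -sX eP1E; setdec.
  have UT : X :|: (e |: P1) \in Tg.
    case: (tg _ UE sI) => // CT; have /eqP[] := tangle3 XT TP CT.
    by clear -UE; setdec.
  have := maxX _ UT (subsetUl _ _) sI.
  rewrite !subUset subxx /= => /andP[_ sP1X].
  by have /negP[] := noP _ sP1X.
have TPQ : P \in Tg \/ e |: Q \in Tg by rewrite -EPc; apply: tg => //; case/and5P: gP => _ _ _ _ /and3P[].
have TQP : Q \in Tg \/ e |: P \in Tg by rewrite -EQc; apply: tg => //; case/and5P: gQ => _ _ _ _ /and3P[].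
case: TPQ => [TP|]; last by move=> TQ; apply: (side Q).
case: TQP => [TQ|]; last by move=> TP'; apply: (side P).
have Te : [set e] \in Tg.
  case: (tg [set e]); rewrite ?sub1set //.
    by apply: rank_le2_sep => //; clear -re1; lia.
  by move=> h; have := tangle1 eE; rewrite h.
have /eqP[] := tangle3 TP TQ Te.
by rewrite /Q; clear -eE PE; setdec.
Qed.
End Tangle.

(** * Duality *)

Section Dual.
Variables (T : finType) (E : {set T}) (r : {set T} -> nat).
Implicit Types (A B C D Y : {set T}) (e : T).
Hypothesis mr : matroid_rank r.

(** Intersecting with [E] gives a rank on all subsets of the type, with the elements outside [E] as
    loops. *)
Definition dual_rank A := #|A :&: E| + r (E :\: A) - r E.

Lemma rank_leU A B C : C \subset A :|: B -> r C <= r A + #|B|.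
Proof.
move=> s; have := submod (D := set0) mr s (sub0set _).
by case: mr => /(_ B); clear; lia.
Qed.

Lemma dual_rankE A : dual_rank A + r E = #|A :&: E| + r (E :\: A).
Proof.
rewrite /dual_rank subnK // addnC; apply: rank_leU; clear; setdec.
Qed.

Lemma dual_rank_dual : rank_dual E r dual_rank.
Proof. by move=> A sA; rewrite dual_rankE (setIidPl sA). Qed.

Lemma dual_rank_dual' : rank_dual E dual_rank r.
Proof.
move=> A sA; have := dual_rankE E; have := dual_rankE (E :\: A).
have -> : E :\: (E :\: A) = A by clear -sA; setdec.
rewrite setIid setDv (rank0 mr) (setIidPl (subsetDl _ _)).
have := cardsID A E; rewrite (setIC E) (setIidPl sA); clear; lia.
Qed.

Lemma dual_matroid_rank : matroid_rank dual_rank.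
Proof.
split=> [A|A B sAB|A B].
- have := dual_rankE A; have : r (E :\: A) <= r E by apply: rank_mono => //; clear; setdec.
  have : #|A :&: E| <= #|A| by apply: subset_leq_card; apply: subsetIl.
  by clear; lia.
- have := dual_rankE A; have := dual_rankE B.
  have : r (E :\: A) <= r (E :\: B) + #|(B :&: E) :\: A|.
    by apply: rank_leU; clear; setdec.
  have := cardsID A (B :&: E).
  have -> : B :&: E :&: A = A :&: E by clear -sAB; setdec.
  by clear; lia.
- have := dual_rankE A; have := dual_rankE B.
  have := dual_rankE (A :|: B); have := dual_rankE (A :&: B).
  have : r (E :\: (A :&: B)) + r (E :\: (A :|: B)) <= r (E :\: A) + r (E :\: B).
    by apply: submod => //; clear; setdec.
  have := cardsUI (A :&: E) (B :&: E).
  have -> : A :&: E :|: B :&: E = (A :|: B) :&: E by clear; setdec.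
  have -> : A :&: E :&: (B :&: E) = A :&: B :&: E by clear; setdec.
  by clear; lia.
Qed.

Lemma dual_conn : conn E r -> conn E dual_rank.
Proof.
move=> cn P sP c1 c2; have := cn P sP c1 c2.
have := dual_rank_dual sP; have := dual_rank_dual (subsetDl E P).
have := dual_rank_dual (subxx E); rewrite setDv (rank0 mr).
have -> : E :\: (E :\: P) = P by clear -sP; setdec.
by have := cardsID P E; rewrite (setIC E) (setIidPl sP); clear; lia.
Qed.
End Dual.

Section DualMinor.
Variables (T : finType) (E G : {set T}) (r rN : {set T} -> nat).
Implicit Types (A B C D Y Z : {set T}) (e : T).
Hypotheses (mr : matroid_rank r) (sG : G \subset E).
Let r' := dual_rank E r.
Let rN' Y := #|Y| + rN (G :\: Y) - rN G.

(** The dual of [N] contracts what [N] deletes. *)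
Lemma contr_set_dual C : contr_set E G r rN C ->
  contr_set E G r' rN' ((E :\: G) :\: C).
Proof.
move=> [sC rC]; split=> [|Y sY]; first exact: subsetDl.
set D := _ :\: C.
have DE : D \subset E by rewrite /D; clear; setdec.
have YDE : Y :|: D \subset E by rewrite /D; clear -sY sG; setdec.
have := dual_rank_dual mr DE; have := dual_rank_dual mr YDE; rewrite -/r'.
have -> : E :\: (Y :|: D) = (G :\: Y) :|: C.
  by rewrite /D; clear -sC sY sG; setdec.
have -> : E :\: D = G :|: C by rewrite /D; clear -sC sG; setdec.
rewrite !rC ?subsetDl //.
have -> : #|Y :|: D| = #|Y| + #|D|.
  have := cardsUI Y D; have -> : Y :&: D = set0 by rewrite /D; clear -sY; setdec.
  by rewrite cards0; clear; lia.
have : rN G <= rN (G :\: Y) + #|Y|.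
  have : r (G :|: C) <= r ((G :\: Y) :|: C) + #|Y| by apply: rank_leU => //; clear; setdec.
  by rewrite !rC ?subsetDl //; clear; lia.
by rewrite /rN'; clear; lia.
Qed.

(** [rN] is an arbitrary function here; [C0] makes it a rank on [G], so that the subtraction in
    [rN'] does not truncate. *)
Lemma contr_set_undual C0 D : contr_set E G r rN C0 -> contr_set E G r' rN' D ->
  contr_set E G r rN ((E :\: G) :\: D).
Proof.
move=> [sC0 rC0] [sD rD]; split=> [|Y sY]; first exact: subsetDl.
set C := _ :\: D.
have rN0 : rN set0 = 0 by have := rC0 set0 (sub0set _); rewrite set0U; clear; lia.
have bnd Z : Z \subset G -> rN G <= rN Z + #|G :\: Z|.
  move=> sZ; have : r (G :|: C0) <= r (Z :|: C0) + #|G :\: Z|.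
    by apply: rank_leU => //; clear; setdec.
  by rewrite !rC0 //; clear; lia.
have eq Z : Z \subset G -> r (Z :|: C) + rN G = rN Z + r (G :|: C).
  move=> sZ; have sGZ : G :\: Z \subset G by apply: subsetDl.
  have DE : D \subset E by clear -sD; setdec.
  have ZDE : (G :\: Z) :|: D \subset E by clear -sG sD; setdec.
  have := rD _ sGZ; have := bnd Z sZ.
  have := dual_rank_dual mr DE; have := dual_rank_dual mr ZDE; rewrite -/r'.
  have -> : E :\: (G :\: Z :|: D) = Z :|: C by rewrite /C; clear -sD sZ sG; setdec.
  have -> : E :\: D = G :|: C by rewrite /C; clear -sD sG; setdec.
  have -> : #|G :\: Z :|: D| = #|G :\: Z| + #|D|.
    have := cardsUI (G :\: Z) D; have -> : (G :\: Z) :&: D = set0 by clear -sD; setdec.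
    by rewrite cards0; clear; lia.
  rewrite /rN'; have -> : G :\: (G :\: Z) = Z by clear -sZ; setdec.
  by clear; lia.
by have := eq Y sY; have := eq set0 (sub0set _); rewrite set0U rN0; clear; lia.
Qed.

Lemma contractible_dual C0 e : contr_set E G r rN C0 ->
  contractible E G r' rN' e <-> deletable E G r rN e.
Proof.
move=> h0; split=> [[D cD eD]|[C cC eC]].
  exists ((E :\: G) :\: D); first exact: contr_set_undual h0 cD.
  by rewrite in_setD [in X in X && _]in_setD eD (subsetP (proj1 cD)).
by exists ((E :\: G) :\: C) => //; apply: contr_set_dual.
Qed.

Lemma deletable_dual C0 e : contr_set E G r rN C0 ->
  deletable E G r' rN' e <-> contractible E G r rN e.
Proof.
move=> h0; split=> [[D cD eD]|[C cC eC]].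
  by exists ((E :\: G) :\: D) => //; apply: contr_set_undual h0 cD.
exists ((E :\: G) :\: C); first exact: contr_set_dual.
by rewrite in_setD [in X in X && _]in_setD eC (subsetP (proj1 cC)).
Qed.
End DualMinor.

(** * From the tangle matroid to the abstract situation *)

Lemma bigmin_le (I : finType) (P : pred I) (F : I -> nat) t i : P i ->
  \big[minn/t]_(j | P j) F j <= F i.
Proof.
have : i \in index_enum I by rewrite mem_index_enum.
elim: (index_enum I) => // a s IH; rewrite inE big_cons => /orP[/eqP <- Pi|/IH h Pi].
  by rewrite Pi geq_minl.
by case: (P a); rewrite ?h // geq_min h ?orbT.
Qed.

(** A value strictly below the default [t] must come from an index. *)
Lemma bigmin_attained (I : finType) (P : pred I) (F : I -> nat) t :
  \big[minn/t]_(j | P j) F j < t ->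
  exists2 i, P i & F i = \big[minn/t]_(j | P j) F j.
Proof.
elim/big_rec: _ => [|i m Pi IH]; first by rewrite ltnn.
rewrite gtn_min; have [le|lt] := leqP (F i) m; first by exists i.
rewrite /minn; move=> h; have mt : m < t by clear -h lt; lia.
have [j Pj ej] := IH mt; exists j => //.
Qed.

Theorem theorem3p1 (T : finType) (M N : mdata T) (Tg : {set {set T}})
    (theta : nat) (X : {set T}) (f : T) :
  is_matroid M -> three_connected M ->
  has_minor M N ->
  (forall e, ~ is_loop N e) -> (forall e, ~ is_coloop N e) ->
  is_tangle M Tg theta -> 3 <= theta ->
  is_long_line (tangle_matroid M Tg theta) X -> f \in X ->
  (X :\ f) :&: ground N = set0 ->
  exists2 e, e \in X :\ f &
    (three_connected (mdelete M e) /\ has_minor (mdelete M e) N) \/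
    (three_connected (mcontract M e) /\ has_minor (mcontract M e) N).
Proof.
move=> [M1 M2 M3] c3 hN nl ncl [T0 T1 T2 T3 T4] th [[[sX clX] rkX] cX] fX XN.
rewrite /= in sX clX rkX.
set E := ground M in T0 T1 T2 T3 T4 sX clX *; set G := ground N in XN *.
pose r (A : {set T}) := rk M (A :&: E).
have rE (A : {set T}) : A \subset E -> r A = rk M A by move=> sA; rewrite /r (setIidPl sA).
have mr : matroid_rank r.
  split=> [A|A B sAB|A B]; rewrite /r.
  - apply: leq_trans (M1 _ (subsetIr _ _)) _; apply: subset_leq_card; apply: subsetIl.
  - by apply: M2; [apply: setSI | apply: subsetIr].
  - by rewrite setIUl setIIl; apply: M3; apply: subsetIr.
have lamE (A : {set T}) : A \subset E -> lambda M A = r A + r (E :\: A) - r E.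
  by move=> sA; rewrite /lambda -/E !rE // subsetDl.
have lam_sep (A : {set T}) : A \subset E -> (lambda M A <= 2) = sep E r A.
  by move=> sA; rewrite lamE // /sep; clear; lia.
have cn : conn E r.
  by move=> P sP cP cP'; have := c3 2 P isT sP cP cP'; rewrite lamE //; clear; lia.
have tg (A : {set T}) : A \subset E -> sep E r A -> A \in Tg \/ E :\: A \in Tg.
  by move=> sA; rewrite -lam_sep // => h; apply: T2 => //; apply: leq_ltn_trans h _.
have rkle (A Y : {set T}) : Y \in Tg -> A \subset Y -> tangle_rk M Tg theta A <= lambda M Y.
  by move=> YT AY; apply: (bigmin_le (P := fun Y => (Y \in Tg) && (A \subset Y))); rewrite YT AY.
(* [X] is closed of tangle rank 2, so a further element [y] of [Y] raises the rank to at least 3, a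
   lower bound for the connectivity of [Y]. *)
have maxX (Y : {set T}) : Y \in Tg -> X \subset Y -> sep E r Y -> Y \subset X.
  move=> YT sXY sY; apply/subsetP => y yY; apply: contraTT sY => yX.
  have yE : y \in E by apply: (subsetP (T0 _ YT)).
  rewrite -lam_sep ?T0 // -ltnNge.
  have := clX y; rewrite inE yX yE => /(_ isT); rewrite rkX => h.
  by apply: leq_trans h _; apply: rkle; rewrite // subUset sub1set yY.
(* Rank 2 is below the default [theta], so a tangle member containing [X] attains it; by [maxX] that
   member is [X]. *)
have [XT sepX] : X \in Tg /\ sep E r X.
  have lt : tangle_rk M Tg theta X < theta by rewrite rkX.
  have [Y /andP[YT sXY] eY] := bigmin_attained lt.
  have sepY : sep E r Y by rewrite -lam_sep ?T0 // eY -/(tangle_rk M Tg theta X) rkX.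
  have eXY : X = Y by apply/eqP; rewrite eqEsubset sXY maxX.
  by rewrite eXY.
(* An empty complement violates the covering axiom of the tangle, a singleton one the axiom on
   [E :\ e]. *)
have cB : 1 < #|E :\: X|.
  rewrite ltnNge; apply/negP => cB; case: (posnP #|E :\: X|) => c0.
    have /eqP[] := T3 X X X XT XT XT; rewrite !setUid; apply/eqP; rewrite eqEsubset sX.
    by rewrite -setD_eq0 -cards_eq0 c0.
  have /cards1P[b eb] : #|E :\: X| == 1 by rewrite eqn_leq cB.
  have bE : b \in E by have : b \in E :\: X by [rewrite eb inE]; rewrite inE => /andP[].
  have := T4 b bE; rewrite -eb.
  by have -> : E :\: (E :\: X) = X by [clear -sX; setdec]; rewrite XT.
have [C0 [D0 [sC0 sD0 dis [eG rkN]]]] := hN; rewrite /= -/E -/G in eG rkN.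
have {}sC0 : C0 \subset E := sC0.
have sG : G \subset E by rewrite eG subsetDl.
have cs0 : contr_set E G r (rk N) C0.
  split; first by rewrite eG; clear -sC0; setdec.
  move=> Y sY; have YE := subset_trans sY sG.
  rewrite (rkN Y sY) !rE //; last by rewrite subUset YE.
  by rewrite subnK //; apply: M2; [apply: subsetUr | rewrite subUset YE].
have XG : X :&: G \subset [set f].
  have h : (X :\ f) :&: G \subset set0 by rewrite XN.
  by clear -h; setdec.
have noloop g : g \in G -> 0 < rk N [set g].
  by move=> gG; rewrite lt0n; apply/eqP => h; apply: (nl g).
have nocoloop g : g \in G -> rk N G <= rk N (G :\ g).
  by move=> gG; rewrite leqNgt; apply/negP => h; apply: (ncl g).
have contr_minor e : contractible E G r (rk N) e -> has_minor (mcontract M e) N.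
  case=> C [sC rC] eC.
  have CE : C \subset E by clear -sC; setdec.
  have eE := subsetP CE _ eC.
  exists (C :\ e), ((E :\: G) :\: C); rewrite /= -/E; split.
  - by clear -CE; setdec.
  - by clear -eC; setdec.
  - by rewrite -setI_eq0; apply/eqP; clear; setdec.
  - split=> /=; first by rewrite -/E -/G; clear -sC sG eC; setdec.
    rewrite -/G => Y sY; have YE := subset_trans sY sG.
    have -> : Y :|: (C :\ e) :|: [set e] = Y :|: C by clear -eC; setdec.
    have -> : C :\ e :|: [set e] = C by clear -eC; setdec.
    have YCE : Y :|: C \subset E by rewrite subUset YE.
    have seE : [set e] \subset E by rewrite sub1set.
    have : r [set e] <= r C by apply: rank_mono; rewrite // sub1set.
    by have := rC Y sY; rewrite -!rE //; clear; lia.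
have del_minor e : deletable E G r (rk N) e -> has_minor (mdelete M e) N.
  case=> C [sC rC] eC.
  have CE : C \subset E by clear -sC; setdec.
  exists C, ((E :\: G) :\: C :\ e); rewrite /= -/E; split.
  - by clear -CE eC; setdec.
  - by clear; setdec.
  - by rewrite -setI_eq0; apply/eqP; clear; setdec.
  - split=> /=; first by rewrite -/E -/G; clear -sC sG eC; setdec.
    rewrite -/G => Y sY; have YE := subset_trans sY sG.
    rewrite !setU0.
    have YCE : Y :|: C \subset E by rewrite subUset YE.
    have := rC Y sY; rewrite -!rE ?sub0set // (rank0 mr); clear; lia.
have dd := dual_rank_dual mr (E := E).
have contr_conn e : e \in E -> conn_contract E r e -> three_connected (mcontract M e).
  move=> eE cc k P kle; rewrite /lambda /= -/E setU0 => sP cP cQ.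
  have := cc k P kle sP cP cQ.
  have -> : P :|: [set e] = e |: P by rewrite setUC.
  have -> : E :\ e :\: P :|: [set e] = e |: (E :\ e :\: P) by rewrite setUC.
  have -> : E :\ e :|: [set e] = E by clear -eE; setdec.
  have h1 : e |: P \subset E by clear -eE sP; setdec.
  have h2 : e |: (E :\ e :\: P) \subset E by clear -eE; setdec.
  have h3 : [set e] \subset E by rewrite sub1set.
  rewrite -!rE //.
  have : r [set e] <= r (e |: P) by apply: rank_mono => //; apply: subsetUl.
  have : r [set e] <= r (e |: (E :\ e :\: P)) by apply: rank_mono => //; apply: subsetUl.
  have : r [set e] <= r E by apply: rank_mono.
  by clear; lia.
have del_conn e : e \in E -> conn_contract E (dual_rank E r) e ->
    three_connected (mdelete M e).
  move=> eE cc k P kle; rewrite /lambda /= -/E set0U => sP cP cQ.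
  have := cc k P kle sP cP cQ; rewrite !setU0.
  set Q := E :\ e :\: P.
  have h1 : e |: P \subset E by clear -eE sP; setdec.
  have h2 : e |: Q \subset E by rewrite /Q; clear -eE; setdec.
  have h3 : [set e] \subset E by rewrite sub1set.
  have PE : P \subset E by clear -sP; setdec.
  have QE : Q \subset E by rewrite /Q; clear; setdec.
  have EeE : E :\ e \subset E by apply: subD1set.
  rewrite -!rE ?sub0set // (rank0 mr).
  have := dd _ h1; have := dd _ h2; have := dd _ h3; have := dd E (subxx _).
  have -> : E :\: (e |: P) = Q by rewrite /Q; clear; setdec.
  have -> : E :\: (e |: Q) = P by rewrite /Q; clear -sP; setdec.
  rewrite setDv (rank0 mr) cards1 !cardsU1.
  have -> : e \notin P by clear -sP; setdec.
  have -> : e \notin Q by rewrite /Q; clear; setdec.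
  have : #|P| + #|Q| + 1 = #|E|.
    have := cardsD1 e E; rewrite eE; have := cardsID P (E :\ e).
    have -> : (E :\ e) :&: P = P by clear -sP; setdec.
    by rewrite -/Q; clear; lia.
  by clear; lia.
(* Assuming that no element works, every removal that keeps [N] must fail 3-connectivity, which
   supplies the guts pairs of both halves of the context. *)
apply: NNPP => no.
pose r' := dual_rank E r.
pose rN' (Y : {set T}) := #|Y| + rk N (G :\: Y) - rk N G.
have mr' : matroid_rank r' := dual_matroid_rank E mr.
have cn' : conn E r' := dual_conn mr cn.
have XfE e : e \in X -> e != f -> e \in X :\ f by move=> eX ef; rewrite !inE ef.
have ctC : half_ctx E X f r r' (contractible E G r (rk N)) (deletable E G r (rk N)).
  split=> //.
  - move=> e eX ef Ce; have eE := subsetP sX _ eX.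
    case: (conn_contract_or_guts sX cB cX XT T3 T4 mr cn tg sepX maxX eX) => // cc.
    case: no; exists e; first exact: XfE.
    by right; split; [apply: contr_conn | apply: contr_minor].
  - by move=> e P p; apply: contractible_guts.
  - by move=> A a b; apply: contractible_triangle.
have sd (A : {set T}) : A \subset E -> sep E r' A = sep E r A by move=> sA; apply: sep_dual.
have rNG : rk N G <= #|G|.
  have : r (G :|: C0) <= r C0 + #|G| by apply: rank_leU => //; rewrite setUC.
  by rewrite (proj2 cs0) //; clear; lia.
have noloop' g : g \in G -> 0 < rN' [set g].
  by move=> gG; rewrite /rN' cards1; have := nocoloop g gG; clear; lia.
have rN0 : rk N set0 = 0.
  by have := proj2 cs0 set0 (sub0set _); rewrite set0U; clear; lia.
have nocoloop' g : g \in G -> rN' G <= rN' (G :\ g).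
  move=> gG; rewrite /rN' setDv rN0.
  have -> : G :\: (G :\ g) = [set g] by clear -gG; setdec.
  have := cardsD1 g G; rewrite gG; have := noloop g gG; clear -rNG; lia.
have cdE (e : T) := contractible_dual mr sG e cs0.
have ddE (e : T) := deletable_dual mr sG e cs0.
have ctD : half_ctx E X f r' r (deletable E G r (rk N)) (contractible E G r (rk N)).
  split=> //; first exact: dual_rank_dual'.
  - move=> e eX ef De; have eE := subsetP sX _ eX.
    have tg' (A : {set T}) : A \subset E -> sep E r' A -> A \in Tg \/ E :\: A \in Tg.
      by move=> sA; rewrite sd //; apply: tg.
    have sepX' : sep E r' X by rewrite sd.
    have maxX' (Y : {set T}) : Y \in Tg -> X \subset Y -> sep E r' Y -> Y \subset X.
      by move=> YT sXY; rewrite sd ?T0 //; apply: maxX.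
    case: (conn_contract_or_guts sX cB cX XT T3 T4 mr' cn' tg' sepX' maxX' eX) => // cc.
    case: no; exists e; first exact: XfE.
    by left; split; [apply: del_conn | apply: del_minor].
  - move=> e P p De sP gP cP pP pf.
    have De' := proj2 (cdE e) De.
    case: (contractible_guts mr' cn' sX cB sG XG noloop' nocoloop' De' sP gP cP pP pf).
      by move=> Cp; left; apply/cdE.
    by right.
  - move=> A a b sA cA rA aA bA ab bf Da; apply/ddE; have Da' := proj2 (cdE a) Da.
    exact: (contractible_triangle mr' cn' sX cB XG noloop' sA cA rA aA bA ab bf Da').
(* Any [e] in [X] other than [f] is outside [G], so the given minor already contracts or deletes
   it. *)
have [e eX ef] : exists2 e, e \in X & e != f by apply: pick_other; apply: ltnW.
have eG' : e \in E :\: G.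
  rewrite inE (subsetP sX) // andbT; apply: contra ef => eG'.
  by have := subsetP XG e; rewrite !inE eX eG' => /(_ isT).
apply: (ctx_absurd sX cB (conj ctC ctD) eX ef).
by have [eC|eC] := boolP (e \in C0); [left | right]; exists C0; rewrite // inE eC.
Qed.
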